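(* A Banach space $E$ is $1$-separably injective if and only if $E$ is (isometric to) a $1$-complemented subspace of some Banach space of $\mathscr{S}$-universal disposition, where $\mathscr{S}$ is the class of separable Banach spaces.
   Context: All Banach spaces are over the same scalar field, operators are bounded and linear, and ''into isometry'' means a linear isometric embedding, not necessarily surjective. A Banach space $E$ is $\lambda$-separably injective if for every separable Banach space $X$ and each subspace $Y\subset X$, every operator $t:Y\to E$ extends to an operator $T:X\to E$ with $\|T\|\le\lambda\|t\|$. For a class $\mathfrak{M}$ of Banach spaces, a Banach space $U$ is of $\mathfrak{M}$-universal disposition if, given $A,B\in\mathfrak{M}$ and into isometries $u:A\to U$ and $\imath:A\to B$, there is an into isometry $u':B\to U$ such that $u=u'\imath$. A closed subspace $Y$ of a Banach space $Z$ is $1$-complemented if there is a linear projection of $Z$ onto $Y$ of norm at most $1$. *)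

(* Defs.v *)
From HB Require Import structures.
From mathcomp Require Import all_boot all_order all_algebra.
From mathcomp Require Import all_classical all_reals all_analysis.
From mathcomp Require Import complex.

Set Implicit Arguments.
Unset Strict Implicit.
Unset Printing Implicit Defensive.

Import Order.TTheory GRing.Theory Num.Theory.
Import numFieldNormedType.Exports.

Local Open Scope classical_set_scope.
Local Open Scope ring_scope.

(* A Banach space over K is a completeNormedModType K; its norm takes values
   in K, also when K is the field of complex numbers R[i]. *)
Inductive scalar_field (R : realType) : numFieldType -> Prop :=
| real_scalars : scalar_field R R
| complex_scalars : scalar_field R R[i].

Definition separable (T : topologicalType) : Prop :=
  exists2 D : set T, countable D & dense D.

Definition separable_banach (K : numFieldType) (X : completeNormedModType K) :
  Prop := separable X.

Section Operators.
Variable K : numFieldType.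

Definition linear_subspace (V : lmodType K) (Y : set V) : Prop :=
  GRing.submod_closed [in Y].

Definition unit_ball_of (V : normedModType K) (Y : set V) : set V :=
  [set y | Y y /\ `|y| <= 1].

(* An operator defined on a subspace Y of V is represented by a function on V
   whose values outside Y are irrelevant. *)
Definition operator_on (V W : normedModType K) (Y : set V) (t : V -> W) :
  Prop :=
  (forall (a : K) (x y : V), Y x -> Y y -> t (a *: x + y) = a *: t x + t y) /\
  [bounded t y | y in unit_ball_of Y].

(* The supremum is taken in the order of K, which is only partial for R[i];
   the upper bounds of a nonempty set of norms are nevertheless real. It is
   the operator norm for bounded t only: unbounded sets have supremum 0 by
   convention. *)
Definition opnorm_on (V W : normedModType K) (Y : set V) (t : V -> W) : K :=
  supremum 0 [set `|t y| | y in unit_ball_of Y].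

Definition into_isometry (V W : normedModType K) (f : {linear V -> W}) : Prop :=
  forall x : V, `|f x| = `|x|.

Definition separably_injective (lambda : K) (E : completeNormedModType K) :
  Prop :=
  forall (X : completeNormedModType K) (Y : set X) (t : X -> E),
    separable X -> linear_subspace Y -> operator_on Y t ->
    exists T : {linear X -> E},
      [/\ operator_on setT T,
          forall y : X, Y y -> T y = t y
        & opnorm_on setT T <= lambda * opnorm_on Y t].

Definition universal_disposition (M : completeNormedModType K -> Prop)
    (U : completeNormedModType K) : Prop :=
  forall (A B : completeNormedModType K)
         (u : {linear A -> U}) (i : {linear A -> B}),
    M A -> M B -> into_isometry u -> into_isometry i ->
    exists2 u' : {linear B -> U}, into_isometry u' & u =1 u' \o i.

Definition one_complemented (Z : normedModType K) (Y : set Z) : Prop :=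
  [/\ linear_subspace Y, closed Y
    & exists P : {linear Z -> Z},
        [/\ operator_on setT P, forall z : Z, P (P z) = P z, range P = Y
          & opnorm_on setT P <= 1]].

Definition isometric_to_subspace (E Z : normedModType K) (Y : set Z) : Prop :=
  exists2 j : {linear E -> Z}, into_isometry j & range j = Y.

End Operators.

(* Main.v *)
(** Being 1-separably injective amounts to an extension property for codes: a
    pair of separable seminormed spaces is a seminorm [N] on pairs of finitely
    supported sequences, and a contraction of the first space given by a sequence
    [c] has to extend to a sequence [v] on the second.

    For the direct implication, instead of iterating push-outs transfinitely,
    take the well-founded countably branching terms generated by [E], linear
    combinations, and one formal extension [Ext N s] for each code [N] and each
    sequence [s] of terms. A world is a scalar assignment on terms belonging to
    some good family of functionals; the worlds are the dual unit ball of a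
    seminorm on the terms, the space [U] is the quotient, and completeness comes
    from extensions that adjoin limits. Extensions are isometric because a world
    and a functional on a code agreeing with it on [s] can be amalgamated. The
    extension property of [E] evaluates terms in [E], which embeds [E] in [U]
    and projects [U] onto it.

    Conversely, a space of universal disposition realizes the push-out of an
    operator along an inclusion of separable spaces, so operators into it, and
    hence into a 1-complemented subspace, extend without increase of norm. *)
Require Import Defs.
From HB Require Import structures.
From mathcomp Require Import all_boot all_order all_algebra.
From mathcomp Require Import all_classical all_reals all_analysis.
From mathcomp Require Import complex.
From mathcomp Require Import ring lra.

Set Implicit Arguments.
Unset Strict Implicit.
Unset Printing Implicit Defensive.

Import Order.TTheory GRing.Theory Num.Theory.
Import numFieldNormedType.Exports.

Local Open Scope classical_set_scope.
Local Open Scope ring_scope.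

(** * Real and complex scalars under one interface *)

(* [jj] is the imaginary unit, or 0 if the scalars are real. *)
Record scalars (R : realType) (K : numFieldType) := Scalars {
  iota : {rmorphism R -> K};
  re : K -> R;
  im : K -> R;
  jj : K;
  dseq : nat -> K;
  ler_iota : forall a b, (iota a <= iota b) = (a <= b);
  reK : forall k, 0 <= k -> iota (re k) = k;
  reim : forall k, k = iota (re k) + jj * iota (im k);
  re_can : forall a b, re (iota a + jj * iota b) = a;
  jj2 : jj = 0 \/ jj * jj = -1;
  re_le : forall k, re k <= re `|k|;
  dseq_dense : forall k (e : R), 0 < e -> exists n, `|k - dseq n| < iota e }.

Lemma real_scalarsP (R : realType) : inhabited (scalars R R).
Proof.
pose d (n : nat) : R := if @unpickle rat n is Some q then ratr q else 0.
constructor.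
apply: (@Scalars R R idfun idfun (fun=> 0) 0 d) => //=.
- by move=> k; rewrite mul0r addr0.
- by move=> a b; rewrite mul0r addr0.
- by left.
- by move=> k; rewrite ler_norm.
move=> k e e0.
have /rat_in_itvoo[q qk] : k - e < k + e by lra.
exists (pickle q); rewrite /d pickleK ltr_norml.
by move: qk; rewrite in_itv/= => /andP[? ?]; apply/andP; split; lra.
Qed.

Lemma complex_scalarsP (R : realType) : inhabited (scalars R R[i]).
Proof.
pose d (n : nat) : R[i] :=
  if @unpickle (rat * rat)%type n is Some q then (ratr q.1 +i* ratr q.2)%C else 0.
have E (a b : R) : (a%:C + 'i * b%:C)%C = (a +i* b)%C.
  by simpc.
constructor.
apply: (@Scalars R R[i] (real_complex R) (@complex.Re R) (@complex.Im R) 'i%C d) => //.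
- by move=> a b; rewrite lecR.
- by move=> [a b]; rewrite lecE /= => /andP[/eqP -> _].
- by move=> [a b]; rewrite E.
- by move=> a b; rewrite E.
- by right; rewrite -expr2 sqr_i.
- move=> [a b]; rewrite normc_def /=.
  apply: (le_trans (ler_norm _)).
  by rewrite -sqrtr_sqr ler_sqrt ?addr_ge0 ?sqr_ge0// lerDl sqr_ge0.
move=> [a b] e e0.
have /rat_in_itvoo[q] : a - e / 2 < a + e / 2 by lra.
rewrite in_itv/= => /andP[q1 q2].
have /rat_in_itvoo[q'] : b - e / 2 < b + e / 2 by lra.
rewrite in_itv/= => /andP[q'1 q'2].
exists (pickle (q, q')); rewrite /d pickleK normc_def /= ltcR.
rewrite -[ltRHS]gtr0_norm// -sqrtr_sqr ltr_sqrt ?exprn_gt0//.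
(* [H1] and [H2] bound the square of each coordinate error by [e ^+ 2 / 4], in a factored form from
   which the goal follows linearly in the monomials. *)
have H1 : 0 < (e / 2 - (a - ratr q)) * (e / 2 + (a - ratr q)).
  by rewrite mulr_gt0//; lra.
have H2 : 0 < (e / 2 - (b - ratr q')) * (e / 2 + (b - ratr q')).
  by rewrite mulr_gt0//; lra.
have : 0 < e ^+ 2 by rewrite exprn_gt0.
by move: H1 H2; lra.
Qed.

Lemma scalar_fieldP (R : realType) (K : numFieldType) :
  scalar_field R K -> inhabited (scalars R K).
Proof. by case; [exact: real_scalarsP | exact: complex_scalarsP]. Qed.

(** * Real-valued norms and seminorms *)

Section ScalarTheory.
Context {R : realType} {K : numFieldType} (S : scalars R K).
Local Notation iota := (iota S).
Local Notation re := (re S).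
Local Notation im := (im S).
Local Notation jj := (jj S).

(** Norms take values in [K]; a real-valued version gives access to suprema, infima and linear
    arithmetic in [R]. *)
Definition nr (V : normedZmodType K) (x : V) : R := re `|x|.

Lemma re_iota a : re (iota a) = a.
Proof. by have := re_can S a 0; rewrite rmorph0 mulr0 addr0. Qed.

Lemma iota_nr (V : normedZmodType K) (x : V) : iota (nr x) = `|x|.
Proof. by rewrite /nr reK. Qed.

Lemma eq_nr (V W : normedZmodType K) (x : V) (y : W) : `|x| = `|y| -> nr x = nr y.
Proof. by rewrite /nr => ->. Qed.

Lemma ltr_iota a b : (iota a < iota b) = (a < b).
Proof. by rewrite !lt_neqAle ler_iota (inj_eq (fmorph_inj _)). Qed.

Lemma iota_ge0 a : (0 <= iota a) = (0 <= a).
Proof. by rewrite -(rmorph0 iota) ler_iota. Qed.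

Lemma iota_gt0 a : (0 < iota a) = (0 < a).
Proof. by rewrite -(rmorph0 iota) ltr_iota. Qed.

Lemma nr_ge0 (V : normedZmodType K) (x : V) : 0 <= nr x.
Proof. by rewrite -iota_ge0 iota_nr. Qed.

Lemma ler_nrD (V : normedZmodType K) (x y : V) : nr (x + y) <= nr x + nr y.
Proof. by rewrite -(ler_iota S) rmorphD /= !iota_nr ler_normD. Qed.

Lemma nrN (V : normedZmodType K) (x : V) : nr (- x) = nr x.
Proof. by rewrite /nr normrN. Qed.

Lemma nr0 (V : normedZmodType K) : nr (0 : V) = 0.
Proof. by rewrite /nr normr0 -(rmorph0 iota) re_iota. Qed.

Lemma nr_eq0 (V : normedZmodType K) (x : V) : nr x <= 0 -> x = 0.
Proof.
move=> h; apply/eqP; rewrite -normr_eq0 -iota_nr.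
have -> : nr x = 0 by apply: le_anti; rewrite h nr_ge0.
by rewrite rmorph0.
Qed.

Lemma nrZ (V : normedModType K) (a : K) (x : V) : nr (a *: x) = nr a * nr x.
Proof.
by apply: (fmorph_inj iota); rewrite rmorphM /= !iota_nr normrZ.
Qed.

Lemma nrM (a b : K) : nr (a * b) = nr a * nr b.
Proof.
by apply: (fmorph_inj iota); rewrite rmorphM /= !iota_nr normrM.
Qed.

Lemma nr_iota a : 0 <= a -> nr (iota a) = a.
Proof. by move=> a0; rewrite /nr ger0_norm ?iota_ge0// re_iota. Qed.

Lemma nr1 : nr (1 : K) = 1.
Proof. by rewrite /nr normr1 -(rmorph1 iota) re_iota. Qed.

Lemma re_le_nr (k : K) : re k <= nr k.
Proof. exact: re_le. Qed.

Lemma reD k l : re (k + l) = re k + re l.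
Proof.
have -> : k + l = iota (re k + re l) + jj * iota (im k + im l).
  by rewrite {1}(reim S k) {1}(reim S l) !rmorphD /=; ring.
by rewrite re_can.
Qed.

Lemma reZ a k : re (iota a * k) = a * re k.
Proof.
have -> : iota a * k = iota (a * re k) + jj * iota (a * im k).
  by rewrite {1}(reim S k) !rmorphM /=; ring.
by rewrite re_can.
Qed.

(** Take the conjugate phase of [k]. This lets bounds and equalities between real parts of linear
    functionals pass to the functionals themselves. *)
Lemma rotate (k : K) : exists2 c : K, nr c <= 1 & c * k = iota (nr k).
Proof.
have [->|k0] := eqVneq k 0.
  by exists 0; rewrite ?nr0 ?ler01// mulr0 rmorph0.
exists (`|k| / k); last by rewrite mulfVK// iota_nr.
rewrite -(ler_iota S) iota_nr rmorph1 normrM normrV ?unitfE// normr_id.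
by rewrite divff ?normr_eq0.
Qed.

Definition seminorm (V : lmodType K) (p : V -> R) : Prop :=
  (forall x y, p (x + y) <= p x + p y) /\
  (forall a x, p (a *: x) = nr a * p x).

Definition lin_on (V W : lmodType K) (Y : set V) (f : V -> W) : Prop :=
  forall a x y, Y x -> Y y -> f (a *: x + y) = a *: f x + f y.

Lemma seminorm_ge0 (V : lmodType K) (p : V -> R) x : seminorm p -> 0 <= p x.
Proof.
move=> [pD pZ].
have := pD x (- x); rewrite subrr -scaleN1r pZ nrN nr1 mul1r.
have := pZ 0 0; rewrite scale0r nr0 mul0r => ->; lra.
Qed.

Lemma seminorm0 (V : lmodType K) (p : V -> R) : seminorm p -> p 0 = 0.
Proof. by move=> [_ pZ]; have := pZ 0 0; rewrite scale0r nr0 mul0r. Qed.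

Lemma seminormN (V : lmodType K) (p : V -> R) x : seminorm p -> p (- x) = p x.
Proof. by move=> [_ pZ]; rewrite -scaleN1r pZ nrN nr1 mul1r. Qed.

Lemma nr_seminorm (V : normedModType K) : seminorm (@nr V).
Proof. by split; [exact: ler_nrD | exact: nrZ]. Qed.

(** * The Hahn-Banach theorem, through minimal sublinear functionals *)

Section HahnBanach.
Variable V : lmodType K.
Implicit Types (q p : V -> R) (x y : V).

Definition sublin q : Prop :=
  (forall x y, q (x + y) <= q x + q y) /\
  (forall r x, 0 < r -> q (iota r *: x) <= r * q x).

Lemma sublin0 q : sublin q -> q 0 = 0.
Proof.
move=> [_ qZ]; have := qZ 2 0; have := qZ (2^-1) 0.
by rewrite !scaler0 => /(_ ltac:(lra)) + /(_ ltac:(lra)); lra.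
Qed.

Lemma sublin_ge q x : sublin q -> - q (- x) <= q x.
Proof.
by move=> hq; have := hq.1 x (- x); rewrite subrr sublin0//; lra.
Qed.

Lemma sublinZ q r x : sublin q -> 0 < r -> q (iota r *: x) = r * q x.
Proof.
move=> hq r0; apply/le_anti; rewrite hq.2//=.
have := hq.2 r^-1 (iota r *: x); rewrite invr_gt0 => /(_ r0).
by rewrite scalerA -rmorphM mulVf ?gt_eqF// rmorph1 scale1r ler_pdivlMl.
Qed.

(* Infimal convolution of a sublinear functional with a convex cone of
   points of the graph of another one. *)
Lemma infconv q (C : V -> R -> Prop) : sublin q -> C 0 0 ->
  (forall x y c d, C x c -> C y d -> C (x + y) (c + d)) ->
  (forall r x c, 0 < r -> C x c -> C (iota r *: x) (r * c)) ->
  (forall x c, C x c -> - q (- x) <= c) ->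
  exists2 q', sublin q' & forall y c, C y c -> forall x, q' x <= q (x - y) + c.
Proof.
move=> hq C0 CD CZ Cq.
pose A x := [set r | exists y c, C y c /\ r = q (x - y) + c].
have An x : A x !=set0 by exists (q (x - 0) + 0), 0, 0.
have Ab x : has_lbound (A x).
  exists (- q (- x)) => r [y [c [Cyc ->]]].
  have := Cq _ _ Cyc; have := hq.1 (x - y) (- x).
  by rewrite addrAC subrr sub0r; lra.
have Al x y c : C y c -> inf (A x) <= q (x - y) + c.
  by move=> h; apply: ge_inf => //; exists y, c.
exists (fun x => inf (A x)); last by move=> y c h x; exact: Al.
split=> [x y|r x r0].
  rewrite -lerBlDr; apply: lb_le_inf => // _ [u [c [Cu ->]]].
  rewrite lerBlDr -lerBlDl; apply: lb_le_inf => // _ [v [d [Cv ->]]].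
  have := Al (x + y) _ _ (CD _ _ _ _ Cu Cv).
  rewrite opprD addrACA; have := hq.1 (x - u) (y - v); lra.
rewrite -ler_pdivrMl//; apply: lb_le_inf => // _ [u [c [Cu ->]]].
rewrite ler_pdivrMl//; apply: (le_trans (Al _ _ _ (CZ _ _ _ r0 Cu))).
by rewrite -scalerBr mulrDr lerD2r hq.2.
Qed.

(** Zorn's lemma for the reversed pointwise order. The pointwise infimum of a nonempty chain is
    finite because every member is at least [- p (- x)]. *)
Lemma sublin_min p : sublin p ->
  exists q, [/\ sublin q, forall x, q x <= p x &
    forall q', sublin q' -> (forall x, q' x <= q x) -> q' = q].
Proof.
move=> hp.
pose T := {q : V -> R | sublin q /\ forall x, q x <= p x}.
pose Rel (s t : T) := `[< forall x, proj1_sig t x <= proj1_sig s x >].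
have [||||t tmax] := @Zorn T Rel.
- by move=> s; apply/asboolP.
- move=> r s t /asboolP h1 /asboolP h2; apply/asboolP => x.
  by apply: (le_trans (h2 x)).
- move=> [s hs] [t ht] /asboolP/= h1 /asboolP/= h2.
  have E : s = t by apply/funext => x; apply/le_anti; rewrite h1 h2.
  by subst t; congr exist; exact: Prop_irrelevance.
- move=> A Atot.
  have [[a0 Aa0]|An] := pselect (A !=set0); last first.
    by exists (exist _ p (conj hp (fun x => lexx _))) => s As; case: An; exists s.
  pose B x := [set r | exists2 s, A s & r = proj1_sig s x].
  have Bn x : B x !=set0 by exists (proj1_sig a0 x), a0.
  have Bb x : has_lbound (B x).
    exists (- p (- x)) => _ [s As ->].
    case: s As => s [hs sp] /= _.
    by have := sublin_ge x hs; have := sp (- x); lra.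
  have Bl x s : A s -> inf (B x) <= proj1_sig s x.
    by move=> As; apply: ge_inf => //; exists s.
  have hq : sublin (fun x => inf (B x)).
    split=> [x y|r x r0].
      rewrite -lerBlDr; apply: lb_le_inf => // _ [s As ->].
      rewrite lerBlDr -lerBlDl; apply: lb_le_inf => // _ [t At ->].
      (* Subadditivity of the infimum needs one member below both [s] and [t]; in a chain the
         smaller of the two will do. *)
      have [m [Am ms mt]] : exists m, [/\ A m,
          forall x, proj1_sig m x <= proj1_sig s x &
          forall x, proj1_sig m x <= proj1_sig t x].
        have [/asboolP h|/asboolP h] := Atot _ _ As At.
          by exists t.
        by exists s.
      have := Bl (x + y) _ Am.
      have := (proj2_sig m).1.1 x y; have := ms x; have := mt y; lra.
    rewrite -ler_pdivrMl//; apply: lb_le_inf => // _ [s As ->].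
    rewrite ler_pdivrMl//; apply: (le_trans (Bl _ _ As)).
    exact: (proj2_sig s).1.2.
  have hqp x : inf (B x) <= p x.
    by apply: (le_trans (Bl _ _ Aa0)); exact: (proj2_sig a0).2.
  exists (exist _ (fun x => inf (B x)) (conj hq hqp)) => s As; apply/asboolP => x /=.
  exact: Bl.
exists (proj1_sig t); split; [exact: (proj2_sig t).1|exact: (proj2_sig t).2|].
move=> q' hq' q't.
have q'p x : q' x <= p x by apply: (le_trans (q't x)); exact: (proj2_sig t).2.
have -> // : t = exist _ q' (conj hq' q'p).
by symmetry; apply: tmax; apply/asboolP.
Qed.

(** A minimal sublinear [q] is additive: its infimal convolution with the ray through [(- y, - q y)]
    lies below [q], hence equals [q], and this says [q x + q y <= q (x + y)]. *)
Lemma sublin_linear p : sublin p ->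
  exists u : V -> R, [/\ forall x y, u (x + y) = u x + u y,
    forall r x, u (iota r *: x) = r * u x & forall x, u x <= p x].
Proof.
move=> /sublin_min[q [hq qp qmin]].
have qD x y : q (x + y) = q x + q y.
  apply/le_anti; rewrite hq.1 /=.
  pose C z c := exists2 t, 0 <= t & z = iota t *: - y /\ c = - (t * q y).
  have [||||q' hq' q'C] := @infconv q C hq.
  - by exists 0 => //; rewrite rmorph0 scale0r mul0r oppr0.
  - move=> _ _ _ _ [s s0 [-> ->]] [t t0 [-> ->]]; exists (s + t); first lra.
    by rewrite rmorphD /= scalerDl; split => //; lra.
  - move=> r _ _ r0 [t t0 [-> ->]]; exists (r * t); first by rewrite mulr_ge0// ltW.
    by rewrite scalerA rmorphM /=; split => //; lra.
  - move=> _ _ [t t0 [-> ->]]; rewrite lerN2 scalerN opprK.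
    move: t0; rewrite le_eqVlt => /orP[/eqP<-|t0]; last by rewrite sublinZ.
    by rewrite rmorph0 scale0r mul0r sublin0.
  have E : q' = q.
    have C00 : C 0 0 by exists 0 => //; rewrite rmorph0 scale0r mul0r oppr0.
    by apply: qmin => // z; have := q'C 0 0 C00 z; rewrite subr0 addr0.
  have := q'C (- y) (- q y); rewrite E => /(_ _ x); rewrite opprK.
  have h : C (- y) (- q y) by exists 1 => //; rewrite rmorph1 scale1r mul1r.
  by move=> /(_ h); lra.
have qN x : q (- x) = - q x.
  by have := qD x (- x); rewrite subrr sublin0//; lra.
exists q; split => // r x.
have [r0|r0|->] := ltrgtP r 0; last by rewrite rmorph0 scale0r mul0r sublin0.
  rewrite -[in LHS](opprK r) rmorphN /= scaleNr qN sublinZ; first lra.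
    exact: hq.
  by rewrite oppr_gt0.
exact: sublinZ.
Qed.

(** The functional is [u x - jj * u (jj x)]. When [jj = 0] the second term vanishes, so the same
    formula serves for real scalars. *)
Lemma complexify (u : V -> R) : (forall x y, u (x + y) = u x + u y) ->
  (forall r x, u (iota r *: x) = r * u x) ->
  exists F : V -> K, (forall x, re (F x) = u x) /\
    forall a x y, F (a *: x + y) = a * F x + F y.
Proof.
move=> uD uZ; pose F x := iota (u x) - jj * iota (u (jj *: x)).
exists F; split=> [x|].
  by rewrite /F -mulrN -rmorphN /= re_can.
have FD x y : F (x + y) = F x + F y.
  by rewrite /F scalerDr !uD !rmorphD /=; ring.
have Fi r x : F (iota r *: x) = iota r * F x.
  have E : jj *: (iota r *: x) = iota r *: (jj *: x) by rewrite !scalerA mulrC.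
  by rewrite /F E !uZ !rmorphM /=; ring.
have Fj x : F (jj *: x) = jj * F x.
  have u0 : u 0 = 0 by have := uZ 0 0; rewrite scaler0 mul0r.
  rewrite /F scalerA; have [->|E] := jj2 S.
    by rewrite !mul0r scale0r u0 rmorph0 subr0.
  have -> : u ((jj * jj) *: x) = - u x.
    by rewrite E -(rmorph1 iota) -rmorphN uZ mulN1r.
  by rewrite mulrBr mulrA E rmorphN /=; ring.
move=> a x y; rewrite FD; congr (_ + _).
by rewrite [in LHS](reim S a) scalerDl FD Fi -scalerA Fj Fi {3}(reim S a); ring.
Qed.

(** Convolving [p] with the graph of [re f] gives a sublinear functional below [p] everywhere and
    below [re f] on [Y]. A real-linear functional under it is then made [K]-linear. *)
Lemma hahn_banach (p : V -> R) (Y : set V) (f : V -> K) : seminorm p ->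
  linear_subspace Y -> lin_on Y (f : V -> K^o) ->
  (forall y, Y y -> nr (f y) <= p y) ->
  exists F : V -> K, [/\ forall a x y, F (a *: x + y) = a * F x + F y,
    forall y, Y y -> F y = f y & forall x, nr (F x) <= p x].
Proof.
move=> hp [Y0 Ylin] flin fp.
have {}Y0 : Y 0 by move: Y0; rewrite inE.
have {}Ylin a x y : Y x -> Y y -> Y (a *: x + y).
  by have := Ylin a x y; rewrite !inE.
have sp : sublin p.
  split; first exact: hp.1.
  by move=> r x r0; rewrite hp.2 nr_iota// ltW.
have f0 : f 0 = 0.
  have := flin 1 0 0 Y0 Y0; rewrite scaler0 addr0 scale1r.
  by move=> /esym/eqP; rewrite -subr_eq0 addrK => /eqP.
have YZ a x : Y x -> Y (a *: x) by move=> Yx; rewrite -[_ *: _]addr0; exact: Ylin.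
have fZ a x : Y x -> f (a *: x) = a * f x.
  by move=> Yx; rewrite -[a *: x]addr0 flin// f0 addr0.
pose C z c := Y z /\ c = re (f z).
have [||||q hq qC] := @infconv p C sp.
- by split=> //; rewrite f0 -(rmorph0 iota) re_iota.
- move=> x y _ _ [Yx ->] [Yy ->]; split.
    by rewrite -[x]scale1r; exact: Ylin.
  by rewrite -reD -[x in RHS]scale1r -[in LHS](scale1r x) flin// !scale1r.
- by move=> r x _ r0 [Yx ->]; split; [exact: YZ|rewrite fZ// reZ].
- move=> x _ [Yx ->]; rewrite seminormN//.
  have := fp _ Yx; have := re_le_nr (- f x); rewrite nrN.
  by rewrite -[- f x]mulN1r -(rmorph1 iota) -rmorphN /= reZ; lra.
have [u [uD uZ uq]] := sublin_linear hq.
have up x : u x <= p x.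
  have C00 : C 0 0 by split => //; rewrite f0 -(rmorph0 iota) re_iota.
  by apply: (le_trans (uq x)); have := qC 0 0 C00 x; rewrite subr0 addr0.
have u0 : u 0 = 0 by have := uZ 0 0; rewrite scaler0 mul0r.
(* On a subspace the inequality [u <= re f] is an equality, by applying it to [- y] too. *)
have uf y : Y y -> u y = re (f y).
  have le z : Y z -> u z <= re (f z).
    move=> Yz; apply: (le_trans (uq z)).
    have := qC z (re (f z)) (conj Yz erefl) z.
    by rewrite subrr seminorm0// add0r.
  move=> Yy; apply/le_anti; rewrite le//=.
  have := le _ (YZ (-1) _ Yy); rewrite fZ// -(rmorph1 iota) -rmorphN uZ reZ; lra.
have [F [Fu Flin]] := complexify uD uZ.
have F0 : F 0 = 0.
  have := Flin 1 0 0; rewrite scaler0 addr0 mul1r.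
  by move=> /esym/eqP; rewrite -subr_eq0 addrK => /eqP.
have FZ a x : F (a *: x) = a * F x by rewrite -[a *: x]addr0 Flin F0 addr0.
exists F; split => // [y Yy|x]; last first.
  have [c c1 cE] := rotate (F x).
  rewrite -[leLHS]re_iota -cE -FZ Fu; apply: (le_trans (up _)).
  rewrite hp.2 -[leRHS]mul1r; apply: ler_wpM2r => //; exact: seminorm_ge0.
(* Real parts agree on all of [Y], in particular after multiplication by the scalar that rotates
   [F y - f y] onto its modulus. *)
apply/eqP; rewrite -subr_eq0; apply/eqP/nr_eq0.
have [c _ cE] := rotate (F y - f y).
rewrite -[leLHS]re_iota -cE mulrBr -FZ -fZ//.
rewrite -[f _]mul1r -(rmorph1 iota) -mulNr -rmorphN reD Fu reZ uf; last exact: YZ.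
lra.
Qed.

End HahnBanach.
End ScalarTheory.

(** * Cauchy sequences and completeness *)

Section Sequences.
Context {R : realType}.

(** The size [p] is arbitrary, so that the notion applies before [V] carries a norm. *)
Definition seqcauchy (V : zmodType) (p : V -> R) (s : nat -> V) : Prop :=
  forall e, 0 < e -> exists N, forall m n, (N <= m)%N -> (N <= n)%N ->
    p (s m - s n) <= e.

Definition seqlim (V : zmodType) (p : V -> R) (s : nat -> V) (x : V) : Prop :=
  forall e, 0 < e -> exists N, forall n, (N <= n)%N -> p (s n - x) <= e.

Lemma harmonic_small (e : R) : 0 < e ->
  exists N, forall n, (N <= n)%N -> (n.+1%:R^-1 : R) < e.
Proof.
move=> e0; have [N hN] := ltr_add_invr e0.
exists N => n Nn; rewrite add0r in hN; apply: le_lt_trans hN.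
by rewrite lef_pV2 ?posrE ?ltr0n// ler_nat ltnS.
Qed.

End Sequences.

Section BanachSequences.
Context {R : realType} {K : numFieldType} (S : scalars R K).
Local Notation iota := (iota S).
Local Notation nr := (@nr R K S _).

Lemma iota_gt0_ex (e : K) : 0 < e -> exists2 r, 0 < r & e = iota r.
Proof.
move=> e0; exists (re S e); last by rewrite reK// ltW.
by rewrite -(iota_gt0 S) reK// ltW.
Qed.

(** A Cauchy filter contains a ball of radius [1 / (n + 1)] for every [n]. The centres form a Cauchy
    sequence, since any two of these balls meet, and the filter converges to its limit. *)
Lemma complete_from_seq (V : normedModType K) :
  (forall s : nat -> V, seqcauchy nr s -> exists x, seqlim nr s x) ->
  forall F : set_system V, ProperFilter F -> cauchy F -> cvg F.
Proof.
move=> Vc F FF Fc.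
have Fb (n : nat) : exists x : V, F (ball x (iota n.+1%:R^-1)).
  have /cauchyP := Fc; apply.
  by rewrite iota_gt0 invr_gt0 ltr0n.
have [s Fs] := choice Fb.
have sc : seqcauchy nr s.
  move=> e e0; have [N hN] := harmonic_small (ltac:(lra) : 0 < e / 2).
  exists N => m n Nm Nn.
  have [z [zm zn]] := filter_ex (filterI (Fs m) (Fs n)).
  move: zm zn; rewrite -!ball_normE /= -!(iota_nr S) !ltr_iota => zm zn.
  have -> : s m - s n = (s m - z) + - (s n - z) by rewrite opprB addrA subrK.
  apply: (le_trans (ler_nrD _ _ _)); rewrite nrN.
  apply: (le_trans (lerD (ltW zm) (ltW zn))).
  by rewrite [leRHS]splitr lerD// ltW// hN.
have [x sx] := Vc _ sc.
apply/cvg_ex; exists x; apply/cvg_ballP => _ /iota_gt0_ex[e e0 ->].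
have [N hN] := harmonic_small (ltac:(lra) : 0 < e / 2).
have [M hM] := sx (e / 2) ltac:(lra).
apply: filterS (Fs (maxn M N)) => z.
rewrite -!ball_normE /= -!(iota_nr S) !ltr_iota => zs.
have -> : x - z = - (s (maxn M N) - x) + (s (maxn M N) - z).
  by rewrite opprB addrA subrK.
apply: (le_lt_trans (ler_nrD _ _ _)); rewrite nrN.
apply: (le_lt_trans (lerD (hM _ (leq_maxl M N)) (ltW zs))).
by rewrite [ltRHS]splitr ler_ltD// hN// leq_maxr.
Qed.

Lemma banach_seqcauchy (V : completeNormedModType K) (s : nat -> V) :
  seqcauchy nr s -> exists x, seqlim nr s x.
Proof.
move=> sc.
have /cauchy_cvg/cvg_ex[x sx] : cauchy (s @ \oo).
  apply: cauchy_exP => _ /iota_gt0_ex[e e0 ->].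
  have [N hN] := sc (e / 2) ltac:(lra).
  exists (s N); exists N => // n Nn; rewrite -ball_normE /= -(iota_nr S) ltr_iota.
  by have := hN _ _ (leqnn N) Nn; lra.
exists x => e e0.
have /cvgrPdist_le/(_ (iota e)) := sx.
rewrite iota_gt0 => /(_ e0)[N _ hN]; exists N => n Nn.
by rewrite -(ler_iota S) iota_nr distrC; exact: hN.
Qed.

End BanachSequences.

(** * Banach spaces carved out of a module *)

(** The norm laws are required on [bM] only: a supremum of values, as used for terms, is well
    behaved just on the functions that are bounded. *)
Record bspace (R : realType) (K : numFieldType) (S : scalars R K) := BSpace {
  bL : lmodType K;
  bM : set bL;
  bp : bL -> R;
  bM0 : bM 0;
  bMlin : forall a x y, bM x -> bM y -> bM (a *: x + y);
  bpD : forall x y, bM x -> bM y -> bp (x + y) <= bp x + bp y;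
  bpZ : forall a x, bM x -> bp (a *: x) = nr S a * bp x;
  bp_ge0 : forall x, bM x -> 0 <= bp x;
  bp0 : forall x, bM x -> bp x = 0 -> x = 0;
  bpC : forall s, (forall n, bM (s n)) -> seqcauchy bp s ->
    exists2 x, bM x & seqlim bp s x }.

Section BspaceBanach.
Context {R : realType} {K : numFieldType} (S : scalars R K).
Variable B : bspace S.

Definition bpred : {pred bL B} := fun x => `[< bM x >].

Record banach_of := BanachOf { bval : bL B; bvalP : bval \in bpred }.

HB.instance Definition _ := [isSub for bval].
HB.instance Definition _ := [Choice of banach_of by <:].

Lemma bpred_closed : GRing.subsemimod_closed bpred.
Proof.
have M0 : 0 \in bpred by apply/asboolP; exact: bM0.
split; [split => //|].
  move=> x y /asboolP Bx /asboolP By; apply/asboolP.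
  by rewrite -[x]scale1r; exact: bMlin.
move=> a x /asboolP Bx; apply/asboolP.
by rewrite -[_ *: _]addr0; apply: bMlin => //; exact: bM0.
Qed.

HB.instance Definition _ :=
  GRing.SubChoice_isSubLmodule.Build K (bL B) bpred banach_of bpred_closed.

Lemma bMval (x : banach_of) : bM (bval x).
Proof. exact/asboolP/(bvalP x). Qed.

Let bnorm (x : banach_of) : K := iota S (bp (bval x)).

Let bnormD x y : bnorm (x + y) <= bnorm x + bnorm y.
Proof. by rewrite /bnorm -rmorphD /= ler_iota; apply: bpD; exact: bMval. Qed.

Let bnormZ a x : bnorm (a *: x) = `|a| * bnorm x.
Proof.
by rewrite /bnorm /= bpZ; [rewrite rmorphM /= iota_nr|exact: bMval].
Qed.

Let bnorm0 x : bnorm x = 0 -> x = 0.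
Proof.
rewrite /bnorm -(rmorph0 (iota S)) => /fmorph_inj h.
by apply: val_inj => /=; apply: bp0 => //; exact: bMval.
Qed.

HB.instance Definition _ :=
  Lmodule_isNormed.Build K banach_of bnormD bnormZ bnorm0.

Lemma nr_bval (x : banach_of) : nr S x = bp (bval x).
Proof. by rewrite /nr re_iota. Qed.

Let bcomplete (F : set_system banach_of) : ProperFilter F -> cauchy F -> cvg F.
Proof.
apply: (complete_from_seq (S := S)) => s sc.
have [||x Bx sx] := bpC (s := bval \o s).
- by move=> n; exact: bMval.
- by move=> e /sc[N hN]; exists N => m n Nm Nn; have := hN _ _ Nm Nn; rewrite nr_bval.
have xP : x \in bpred by apply/asboolP.
exists (BanachOf xP) => e /sx[N hN]; exists N => n Nn.
by rewrite nr_bval; exact: hN.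
Qed.

HB.instance Definition _ := Uniform_isComplete.Build banach_of bcomplete.

Definition banach : completeNormedModType K := banach_of.

End BspaceBanach.

(** * Linear combinations of sequences *)

Section Combinations.
Context {R : realType} {K : numFieldType}.
Implicit Types (V W : lmodType K) (f g : {poly K}).

(** A polynomial stands for a finitely supported scalar sequence, with ['X^n] as its [n]-th unit
    vector. *)
Definition ev V (w : nat -> V) f : V := \sum_(i < size f) f`_i *: w i.

Lemma ev_wide V (w : nat -> V) f n : (size f <= n)%N ->
  ev w f = \sum_(i < n) f`_i *: w i.
Proof.
move=> fn; rewrite /ev (big_ord_widen n (fun i => f`_i *: w i))//.
rewrite big_mkcond; apply: eq_bigr => i _; case: ifP => // /negbT.
by rewrite -leqNgt => h; rewrite nth_default// scale0r.
Qed.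

Lemma ev_lin V (w : nat -> V) a f g : ev w (a *: f + g) = a *: ev w f + ev w g.
Proof.
set n := maxn (size f) (size g).
rewrite (@ev_wide _ w f n) ?leq_maxl// (@ev_wide _ w g n) ?leq_maxr//.
rewrite (@ev_wide _ w _ n); last first.
  apply: (leq_trans (size_polyD _ _)); rewrite geq_max leq_maxr andbT.
  by apply: (leq_trans (size_scale_leq _ _)); rewrite leq_maxl.
rewrite scaler_sumr -big_split; apply: eq_bigr => i _ /=.
by rewrite coefD coefZ scalerDl scalerA.
Qed.

Lemma ev0 V (w : nat -> V) : ev w 0 = 0.
Proof. by rewrite /ev size_poly0 big_ord0. Qed.

Lemma evD V (w : nat -> V) f g : ev w (f + g) = ev w f + ev w g.
Proof. by rewrite -[f]scale1r ev_lin !scale1r. Qed.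

Lemma evZ V (w : nat -> V) a f : ev w (a *: f) = a *: ev w f.
Proof. by rewrite -[a *: f]addr0 ev_lin ev0 addr0. Qed.

Lemma evN V (w : nat -> V) f : ev w (- f) = - ev w f.
Proof. by rewrite -[- f]scaleN1r evZ scaleN1r. Qed.

Lemma evXn V (w : nat -> V) n : ev w 'X^n = w n.
Proof.
rewrite /ev size_polyXn big_ord_recr /= big1 ?add0r.
  by rewrite coefXn eqxx scale1r.
by move=> i _; rewrite coefXn ltn_eqF// scale0r.
Qed.

Lemma poly_evX f : f = ev (fun n => 'X^n : {poly K}) f.
Proof. by rewrite -{1}[f]coefK poly_def. Qed.

Lemma lin_ev V W (T : V -> W) (w : nat -> V) f :
  (forall a x y, T (a *: x + y) = a *: T x + T y) ->
  T (ev w f) = ev (T \o w) f.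
Proof.
move=> Tlin.
have T0 : T 0 = 0.
  have := Tlin 1 0 0; rewrite scaler0 addr0 scale1r.
  by move=> /esym/eqP; rewrite -subr_eq0 addrK => /eqP.
rewrite /ev; elim: (size f) => [|n IH]; first by rewrite !big_ord0.
by rewrite !big_ord_recr /= addrC Tlin IH addrC.
Qed.

Lemma poly_lin V (l : {poly K} -> V) f :
  (forall a x y, l (a *: x + y) = a *: l x + l y) ->
  l f = ev (fun n => l 'X^n) f.
Proof. by move=> llin; rewrite {1}[f]poly_evX lin_ev. Qed.

Lemma eq_ev V (w v : nat -> V) : w =1 v -> ev w =1 ev v.
Proof. by move=> wv f; apply: eq_bigr => i _; rewrite wv. Qed.

Lemma ev_pair f g :
  (f, g) = ev (fun n => ('X^n, 0) : {poly K} * {poly K}) f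
         + ev (fun n => (0, 'X^n) : {poly K} * {poly K}) g.
Proof.
have inl_lin a (x y : {poly K}) :
  ((a *: x + y, 0) : {poly K} * {poly K}) = a *: (x, 0) + (y, 0).
  by congr pair; rewrite /= scaler0 addr0.
have inr_lin a (x y : {poly K}) :
  ((0, a *: x + y) : {poly K} * {poly K}) = a *: (0, x) + (0, y).
  by congr pair; rewrite /= scaler0 addr0.
rewrite -(@poly_lin ({poly K} * {poly K})%type (fun x => (x, 0)))//.
rewrite -(@poly_lin ({poly K} * {poly K})%type (fun x => (0, x)))//.
by congr pair; rewrite /= ?addr0 ?add0r.
Qed.

Lemma lin_ev_pair V (F : {poly K} * {poly K} -> V) f g :
  (forall a x y, F (a *: x + y) = a *: F x + F y) ->
  F (f, g) = ev (fun n => F ('X^n, 0)) f + ev (fun n => F (0, 'X^n)) g.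
Proof.
move=> Flin; rewrite ev_pair.
rewrite -[ev _ f]scale1r.
rewrite Flin scale1r.
rewrite (lin_ev _ _ Flin).
by rewrite (lin_ev _ _ Flin).
Qed.

End Combinations.

(** * Hahn-Banach for sequences, and the extension property *)

Section HahnBanachSequence.
Context {R : realType} {K : numFieldType} (S : scalars R K).
Local Notation nr := (@nr R K S _).
Local Notation PP := ({poly K} * {poly K})%type.

(** The domination makes [ev w f |-> ev c f] well defined on the span of [w]: if two polynomials
    give the same vector, their difference is sent to a scalar of norm at most [p 0 = 0]. *)
Lemma hahn_banach_seq (V : lmodType K) (p : V -> R) (w : nat -> V)
    (c : nat -> K^o) : seminorm S p ->
  (forall f, nr (ev c f) <= p (ev w f)) ->
  exists F : V -> K^o, [/\ forall a x y, F (a *: x + y) = a *: F x + F y,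
    forall n, F (w n) = c n & forall x, nr (F x) <= p x].
Proof.
move=> hp hc; pose Y := [set x | exists f, x = ev w f].
pose h (x : V) : K^o := ev c (xget 0 [set f | x = ev w f]).
have hE f : h (ev w f) = ev c f.
  rewrite /h; case: xgetP => [g _ /= gE|/(_ f)]; last by case.
  apply/eqP; rewrite -subr_eq0; apply/eqP/(@nr_eq0 _ _ S).
  apply: (le_trans (y := nr (ev c (g - f)))); first by rewrite evD evN.
  apply: (le_trans (hc _)).
  have -> : ev w (g - f) = 0 by rewrite evD evN -gE subrr.
  by rewrite (seminorm0 hp).
have [||y [f ->]|F [Flin FY Fp]] := @hahn_banach _ _ S V p Y h hp.
- split; first by rewrite inE; exists 0; rewrite ev0.
  move=> a x y; rewrite !inE => -[f ->] [g ->].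
  by exists (a *: f + g); rewrite ev_lin.
- by move=> a x y [f ->] [g ->]; rewrite -ev_lin !hE ev_lin.
- by rewrite hE.
exists F; split => // n; rewrite -(evXn w) FY ?hE ?evXn//.
by exists 'X^n; rewrite evXn.
Qed.

Lemma norming (V : lmodType K) (p : V -> R) (x : V) : seminorm S p ->
  exists F : V -> K^o, [/\ forall a x y, F (a *: x + y) = a *: F x + F y,
    F x = iota S (p x) & forall y, nr (F y) <= p y].
Proof.
(* The line through [x] is presented as the span of the sequence [x, 0, 0, ...]. *)
move=> hp; pose w n := if n is 0%N then x else 0.
pose c n : K^o := if n is 0%N then iota S (p x) else 0.
have ev_head (L : lmodType K) (y : L) f :
    ev (fun n => if n is 0%N then y else 0) f = f`_0 *: y.
  rewrite (@ev_wide _ _ _ _ (size f).+1)// big_ord_recl /= big1 ?addr0//.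
  by move=> i _; rewrite scaler0.
have [f|F [Flin Fw Fp]] := @hahn_banach_seq V p w c hp.
  rewrite /c /w !ev_head hp.2 (nrM S) nr_iota//; exact: (seminorm_ge0 _ hp).
by exists F; split => //; exact: (Fw 0%N).
Qed.

(* The code [N] of a pair of seminormed spaces (the first factor and the whole
   product) and a contraction of the first factor determined by [c]. *)
Definition extends (V : normedModType K) (N : PP -> R) (c v : nat -> V) : Prop :=
  forall f g, nr (ev c f + ev v g) <= N (f, g).

Definition extension_property (V : normedModType K) : Prop :=
  forall (N : PP -> R) (c : nat -> V), seminorm S N ->
    (forall f, nr (ev c f) <= N (f, 0)) -> exists v, extends N c v.

Lemma scalar_extension_property : extension_property K^o.
Proof.
move=> N c hN hc; pose w n : PP := ('X^n, 0).
have evw f : ev w f = (f, 0).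
  rewrite [RHS]ev_pair.
  by rewrite ev0 addr0.
have [f|F [Flin Fw Fp]] := @hahn_banach_seq _ N w c hN; first by rewrite evw.
exists (fun n => F (0, 'X^n)) => f g; apply: le_trans (Fp (f, g)).
have E : ev c f = ev (fun n => F ('X^n, 0)) f by apply: eq_ev => n; rewrite -Fw.
by rewrite (lin_ev_pair f g Flin) E.
Qed.

End HahnBanachSequence.

(** * Terms, worlds and the seminorm on terms *)

Section Terms.
Context {R : realType} {K : numFieldType} (S : scalars R K).
Variable X : normedModType K.
Local Notation nr := (@nr R K S _).
Local Notation PP := ({poly K} * {poly K})%type.

(* [Lin a s t] stands for [a s + t]; [Ext N s] is the sequence that extends
   the span of [s] to the separable space coded by [N]. *)
Inductive term :=
| Base of X
| Lin of K & term & term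
| Ext of (PP -> R) & (nat -> term) & nat.

(** The last clause concerns every function [N], seminorm or not, so that each term has uniformly
    bounded values; hence the absolute value. *)
Definition assignment (phi : term -> K^o) : Prop :=
  [/\ forall a x y, phi (Base (a *: x + y)) = a *: phi (Base x) + phi (Base y),
      forall a s t, phi (Lin a s t) = a *: phi s + phi t,
      forall x, nr (phi (Base x)) <= nr x
    & forall N s n, nr (phi (Ext N s n)) <= `|N (0, 'X^n)| ].

(* Domination on the span of the first sequence is required of the whole
   family, so that unions of good families are good. *)
Definition good (Phi : set (term -> K^o)) : Prop :=
  (forall phi, Phi phi -> assignment phi) /\
  forall (N : PP -> R) (s : nat -> term), seminorm S N ->
    (forall phi f, Phi phi -> nr (ev (phi \o s) f) <= N (f, 0)) ->
    forall phi, Phi phi -> extends S N (phi \o s) (phi \o Ext N s).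

Definition world (phi : term -> K^o) : Prop := exists2 Phi, good Phi & Phi phi.

(** A domination that holds for all worlds holds on each good family, so the worlds form the largest
    one. *)
Lemma good_world : good world.
Proof.
split=> [phi [Phi [h _] /h//]|N s hN hd phi [Phi gP Pphi]].
apply: gP.2 => // psi f Ppsi; apply: hd; by exists Phi.
Qed.

(** This keeps the suprema over all worlds from being taken over an empty set. *)
Lemma world0 : world (fun=> 0).
Proof.
exists [set fun=> 0] => //; split=> [_ ->|N s hN hd _ -> f g].
  by split=> *; rewrite ?scaler0 ?addr0 ?nr0 ?nr_ge0// normr_ge0.
have ev0' (h : {poly K}) : ev (fun _ : nat => 0 : K^o) h = 0.
  by rewrite /ev big1// => i _; rewrite scaler0.
by rewrite /comp /= !ev0' addr0 nr0; exact: (seminorm_ge0 _ hN).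
Qed.

Definition worlds := {phi | world phi}.

Definition pt (t : term) : R := sup (range (fun phi : worlds => nr (sval phi t))).

Lemma world_bounded t : exists M, forall phi, world phi -> nr (phi t) <= M.
Proof.
have wa phi : world phi -> assignment phi by exact: good_world.1.
elim: t => [x|a s [M hM] t [M' hM']|N s _ n].
- by exists (nr x) => phi /wa[].
- exists (nr a * M + M') => phi w; have [_ -> _ _] := wa _ w.
  apply: (le_trans (ler_nrD _ _ _)); rewrite nrZ lerD ?hM'//.
  by rewrite ler_wpM2l ?nr_ge0 ?hM.
- by exists `|N (0, 'X^n)| => phi /wa[].
Qed.

Lemma pt_ub phi t : world phi -> nr (phi t) <= pt t.
Proof.
move=> w; apply: ub_le_sup; last by exists (exist _ phi w).
by have [M hM] := world_bounded t; exists M => _ [[psi wp] _ <-]; exact: hM.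
Qed.

Lemma pt_le t c : (forall phi, world phi -> nr (phi t) <= c) -> pt t <= c.
Proof.
move=> h; apply: ge_sup; first by exists (nr (0 : K^o)), (exist _ _ world0).
by move=> _ [[phi w] _ <-]; exact: h.
Qed.

Fixpoint lincomb (s : nat -> term) (c : seq K) (n : nat) : term :=
  if c is a :: c' then Lin a (s n) (lincomb s c' n.+1) else Base 0.

Definition linear_assignment (phi : term -> K^o) : Prop :=
  (forall a x y, phi (Base (a *: x + y)) = a *: phi (Base x) + phi (Base y)) /\
  (forall a s t, phi (Lin a s t) = a *: phi s + phi t).

Definition tev (s : nat -> term) (f : {poly K}) : term := lincomb s f 0.

Lemma tevE (V : lmodType K) (phi : term -> V) s f :
  phi (Base 0) = 0 -> (forall a s t, phi (Lin a s t) = a *: phi s + phi t) ->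
  phi (tev s f) = ev (phi \o s) f.
Proof.
move=> p0 plin.
have h (c : seq K) n :
    phi (lincomb s c n) = \sum_(i < size c) c`_i *: phi (s (n + i)%N).
  elim: c n => [|a c IH] n /=; first by rewrite big_ord0.
  rewrite plin IH big_ord_recl /= addn0; congr (_ + _).
  by apply: eq_bigr => i _; rewrite /bump /= addnA addn1.
by rewrite /tev h /ev; apply: eq_bigr.
Qed.

Lemma linear_assignment0 phi : linear_assignment phi -> phi (Base 0) = 0.
Proof.
move=> [h _]; have := h 1 0 0; rewrite scaler0 addr0 scale1r.
by move=> /esym/eqP; rewrite -subr_eq0 addrK => /eqP.
Qed.

Lemma linear_assignment_tev phi s f : linear_assignment phi ->
  phi (tev s f) = ev (phi \o s) f.
Proof. by move=> h; apply: tevE; [exact: linear_assignment0|exact: h.2]. Qed.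

Lemma world_linear phi : world phi -> linear_assignment phi.
Proof. by move=> /good_world.1[]. Qed.

Lemma linear_assignment_node phi N s f g : linear_assignment phi ->
  phi (Lin 1 (tev s f) (tev (Ext N s) g)) =
  ev (phi \o s) f + ev (phi \o Ext N s) g.
Proof. by move=> h; rewrite h.2 scale1r !linear_assignment_tev. Qed.

(** The linear assignments below [pt] form a good family: the worlds are among them, so a domination
    on the family holds for the worlds, which bounds [pt] at the combinations of [s] and [Ext N s].
    Thus the worlds are the whole dual unit ball of [pt]. *)
Lemma world_maximal phi : linear_assignment phi ->
  (forall t, nr (phi t) <= pt t) -> world phi.
Proof.
move=> hl hp.
exists [set phi | linear_assignment phi /\ forall t, nr (phi t) <= pt t] => //.
split=> [{hl hp} {}phi [hl hp]|N s hN hd {hl hp} {}phi [hl hp] f g].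
  split; [exact: hl.1|exact: hl.2| |] => *; apply: (le_trans (hp _)).
    by apply: pt_le => psi /good_world.1[].
  by apply: pt_le => psi /good_world.1[].
rewrite -linear_assignment_node//; apply: (le_trans (hp _)).
apply: pt_le => psi wpsi; rewrite linear_assignment_node; last exact: world_linear.
apply: good_world.2 => // chi h wchi; apply: hd.
by split; [exact: world_linear|move=> t; exact: pt_ub].
Qed.

(** Terms at [pt]-distance zero become equal as functions on worlds, so the range of [den] realizes
    the quotient without forming classes. *)
Definition den (t : term) : worlds -> K^o := fun phi => sval phi t.

Definition supn (x : worlds -> K^o) : R := sup (range (fun phi => nr (x phi))).

Lemma denLin a s t : den (Lin a s t) = a *: den s + den t.
Proof. by apply/funext => -[phi w]; rewrite /den /= (world_linear w).2. Qed.

Lemma den0 : den (Base 0) = 0.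
Proof.
by apply/funext => -[phi w]; rewrite /den /= linear_assignment0//; exact: world_linear.
Qed.

Lemma den_tev s f : den (tev s f) = ev (den \o s) f.
Proof. by apply: tevE; [exact: den0|exact: denLin]. Qed.

Lemma pt_lin a s t : pt (Lin a s t) <= nr a * pt s + pt t.
Proof.
apply: pt_le => phi w; rewrite (world_linear w).2.
apply: (le_trans (ler_nrD _ _ _)); rewrite nrZ lerD ?pt_ub//.
by rewrite ler_wpM2l ?nr_ge0 ?pt_ub.
Qed.

Lemma pt_ge0 t : 0 <= pt t.
Proof. by apply: le_trans (pt_ub t world0); rewrite nr_ge0. Qed.

Lemma supnD x y : range den x -> range den y -> supn (x + y) <= supn x + supn y.
Proof.
move=> [s _ <-] [t _ <-]; have := pt_lin 1 s t.
by rewrite nr1 mul1r /pt -/(supn (den _)) denLin scale1r.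
Qed.

Lemma supnZ a x : range den x -> supn (a *: x) = nr a * supn x.
Proof.
move=> [t _ <-]; have h b s : supn (b *: den s) <= nr b * supn (den s).
  have := pt_lin b s (Base 0).
  rewrite /pt -!/(supn (den _)) denLin den0 addr0.
  have -> : supn 0 = 0; last by rewrite addr0.
  apply/le_anti/andP; split; last by rewrite -den0; exact: pt_ge0.
  by rewrite -den0; apply: pt_le => phi /world_linear/linear_assignment0 ->; rewrite nr0.
apply/le_anti; rewrite h/=.
have [->|a0] := eqVneq a 0.
  by rewrite nr0 mul0r -[_ *: _]addr0 -den0 -denLin; exact: pt_ge0.
have na : 0 < nr a.
  rewrite lt_neqAle nr_ge0 andbT eq_sym; apply: contra_neq a0 => h0.
  by apply: (nr_eq0 (S := S)); rewrite h0.
have := h a^-1 (Lin a t (Base 0)).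
rewrite denLin den0 addr0 scalerA mulVf// scale1r => h1.
rewrite -ler_pdivlMl//; apply: (le_trans h1); rewrite ler_wpM2r//.
  by rewrite -[_ *: _]addr0 -den0 -denLin; exact: pt_ge0.
by rewrite -[leRHS]mulr1 ler_pdivlMl// -nrM divff// nr1.
Qed.

End Terms.

(** * The Banach space of terms *)

Section TermSpace.
Context {R : realType} {K : numFieldType} (S : scalars R K).
Variable X : normedModType K.
Local Notation nr := (@nr R K S _).
Local Notation PP := ({poly K} * {poly K})%type.
Local Notation term := (@term R K X).
Local Notation den := (@den R K S X).
Local Notation supn := (@supn R K S X).
Local Notation pt := (@pt R K S X).
Local Notation world := (@world R K S X).

Lemma real_seqcauchy_cvg (a : nat -> R) :
  seqcauchy (fun x : R => `|x|) a -> cvgn a.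
Proof.
move=> ac; apply: cauchy_cvg; apply: cauchy_exP => e e0.
have [N hN] := ac (e / 2) ltac:(lra).
exists (a N); exists N => // n Nn; rewrite -ball_normE /=.
by have := hN _ _ (leqnn N) Nn; lra.
Qed.

Lemma supn_den t : supn (den t) = pt t.
Proof. by []. Qed.

Lemma range_den_lin a x y : range den x -> range den y -> range den (a *: x + y).
Proof. by move=> [s _ <-] [t _ <-]; exists (Lin a s t) => //; rewrite denLin. Qed.

Lemma range_den0 : range den 0.
Proof. by exists (Base 0) => //; rewrite den0. Qed.

Lemma range_denZ a x : range den x -> range den (a *: x).
Proof.
by move=> hx; rewrite -[_ *: _]addr0; apply: range_den_lin => //; exact: range_den0.
Qed.

Lemma range_denB x y : range den x -> range den y -> range den (x - y).
Proof. by move=> hx hy; rewrite addrC -scaleN1r; exact: range_den_lin. Qed.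

Lemma supn_ge0 x : range den x -> 0 <= supn x.
Proof. by move=> [t _ <-]; exact: pt_ge0. Qed.

Lemma supn_eq0 x : range den x -> supn x = 0 -> x = 0.
Proof.
move=> [t _ <-]; rewrite supn_den => t0; apply/funext => -[phi w].
by apply: (nr_eq0 (S := S)); rewrite -t0; exact: pt_ub.
Qed.

Lemma world_node (phi : term -> K^o) N s f g : world phi -> seminorm S N ->
  (forall f, pt (tev s f) <= N (f, 0)) ->
  nr (ev (phi \o s) f + ev (phi \o Ext N s) g) <= N (f, g).
Proof.
move=> w hN hs; apply: (good_world S X).2 => // psi h wpsi.
rewrite -linear_assignment_tev; last exact: (world_linear wpsi).
by apply: le_trans (hs _); exact: pt_ub.
Qed.

(* The limit of a Cauchy sequence [s] is the new vector of the extension coded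
   by the seminorm [lim_n |ev s f + g_0 s_n|]. *)
Lemma term_complete (s : nat -> _) : (forall n, range den (s n)) ->
  seqcauchy supn s -> exists2 x, range den x & seqlim supn s x.
Proof.
move=> sM sc.
have /choice[t tE] n : exists t, den t = s n by have [t _ tn] := sM n; exists t.
have eM f : range den (ev s f).
  exists (tev t f) => //; rewrite den_tev; apply: eq_ev => n; exact: tE.
pose A (x : PP) n := supn (ev s x.1 + x.2`_0 *: s n).
have AM (x : PP) n : range den (ev s x.1 + x.2`_0 *: s n).
  by rewrite addrC; exact: range_den_lin.
have supnE a x : range den x -> supn (a *: x) = nr a * supn x by exact: supnZ.
have Ale x m n : A x m - A x n <= nr x.2`_0 * supn (s m - s n).
  rewrite lerBlDr -supnE; last exact: range_denB.
  have -> : A x m = supn (x.2`_0 *: (s m - s n) + (ev s x.1 + x.2`_0 *: s n)).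
    by rewrite /A scalerBr addrCA subrK.
  by apply: supnD => //; apply: range_denZ; exact: range_denB.
have Ac x : cvgn (A x).
  apply: real_seqcauchy_cvg => e e0.
  have [N hN] := sc (e / (nr x.2`_0 + 1)) ltac:(rewrite divr_gt0// ltr_wpDl ?nr_ge0//).
  have h m n : (N <= m)%N -> (N <= n)%N -> A x m - A x n <= e.
    move=> Nm Nn; apply: (le_trans (Ale _ _ _)).
    apply: (le_trans (ler_wpM2l (nr_ge0 _ _) (hN _ _ Nm Nn))).
    rewrite mulrA ler_pdivrMr ?ltr_wpDl ?nr_ge0// mulrC ler_pM2l// lerDl//.
  by exists N => m n Nm Nn; rewrite ler_norml h// andbT lerNl opprB h.
pose N (x : PP) := limn (A x).
have hN : seminorm S N.
  split=> [x y|a x].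
    rewrite /N -limD//; apply: ler_lim; [exact: Ac|exact: is_cvgD|].
    near=> n; rewrite fctE /A /= evD coefD scalerDl addrACA.
    exact: supnD.
  rewrite /N -[nr a * _]/(nr a *: limn (A x)) -limZr//.
  congr (limn _); apply/funext => n /=; rewrite /A /= evZ coefZ -scalerA -scalerDr.
  by rewrite supnE.
(* With second component zero the sequence [A (f, 0)] is constant, so [N] restricts to the given
   norm on the span of [s]. *)
have N0 f : pt (tev t f) <= N (f, 0).
  rewrite -supn_den den_tev.
  have -> : ev (den \o t) f = ev s f by apply: eq_ev => n; exact: tE.
  suff -> : N (f, 0) = supn (ev s f) by [].
  rewrite /N (_ : A (f, 0) = fun=> supn (ev s f)); first exact: lim_cst.
  by apply/funext => n; rewrite /A /= coef0 scale0r addr0.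
exists (den (Ext N t 0)); first by exists (Ext N t 0).
move=> e /sc[M hM]; exists M => k Mk.
have -> : s k - den (Ext N t 0) = den (Lin (-1) (Ext N t 0) (t k)).
  by rewrite denLin scaleN1r addrC tE.
apply: pt_le => phi w.
rewrite (world_linear w).2 scaleN1r addrC.
(* The difference between [s k] and the new vector is coded by [('X^k, - 'X^0)], whose seminorm is
   the limit over [n] of the norm of [s k - s n]. *)
have -> : phi (t k) - phi (Ext N t 0) =
    ev (phi \o t) 'X^k + ev (phi \o Ext N t) (- 'X^0) by rewrite evN !evXn.
apply: (le_trans (world_node _ _ w hN N0)).
apply: limr_le; first exact: Ac.
near=> n; rewrite /A /= evXn coefN coefXn eqxx scaleN1r; apply: hM => //.
by near: n; exact: nbhs_infty_ge.
Unshelve. all: by end_near. Qed.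

Definition term_bspace : bspace S :=
  BSpace range_den0 range_den_lin (@supnD R K S X) (@supnZ R K S X)
    supn_ge0 supn_eq0 term_complete.

Definition term_space : completeNormedModType K := banach term_bspace.

End TermSpace.

(** * Canonical choice of extensions *)

Section Choice.
Context {R : realType} {K : numFieldType} (S : scalars R K).
Local Notation nr := (@nr R K S _).
Local Notation PP := ({poly K} * {poly K})%type.
Variable V : normedModType K.

(** The zero sequence is the default, so that the bound by [N (0, 'X^n)] survives when no extension
    exists. *)
Definition chosen_extension (N : PP -> R) (c : nat -> V) : nat -> V :=
  xget (fun=> 0) [set v | extends S N c v].

Lemma chosen_extensionP (N : PP -> R) (c : nat -> V) :
  (exists v, extends S N c v) -> extends S N c (chosen_extension N c).
Proof. by move=> [v hv]; rewrite /chosen_extension; case: xgetP => [_ -> //|/(_ v)]. Qed.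

Lemma chosen_extension_bound (N : PP -> R) (c : nat -> V) n :
  nr (chosen_extension N c n) <= `|N (0, 'X^n)|.
Proof.
rewrite /chosen_extension; case: xgetP => [v _ /= h|_]; last by rewrite nr0.
have := h 0 'X^n; rewrite ev0 add0r evXn => /le_trans; apply; exact: ler_norm.
Qed.

End Choice.

(** * Amalgamating a world with a functional on a code *)

Section Free.
Context {R : realType} {K : numFieldType} (S : scalars R K).
Variable X : normedModType K.
Local Notation nr := (@nr R K S _).
Local Notation PP := ({poly K} * {poly K})%type.
Local Notation term := (@term R K X).
Local Notation pt := (@pt R K S X).
Local Notation world := (@world R K S X).
Implicit Types (t u v : term).

Fixpoint occurs u t : Prop := t = u \/ match t with
  | Base _ => False
  | Lin _ x y => occurs u x \/ occurs u y
  | Ext _ s _ => exists k, occurs u (s k)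
  end.

Definition occurs_below u t : Prop := match t with
  | Base _ => False
  | Lin _ x y => occurs u x \/ occurs u y
  | Ext _ s _ => exists k, occurs u (s k)
  end.

Lemma occursE u t : occurs u t <-> t = u \/ occurs_below u t.
Proof. by case: t. Qed.

Lemma occurs_trans u v t : occurs u v -> occurs v t -> occurs u t.
Proof.
move=> uv; elim: t => [x|a x IHx y IHy|N s IH n] /occursE[-> //|/=].
- by [].
- by move=> [/IHx|/IHy] h; right; [left|right].
- by move=> [k /IH h]; right; exists k.
Qed.

Lemma occurs_below_trans u v t : occurs u v -> occurs_below v t -> occurs_below u t.
Proof.
move=> uv; case: t => [//|a x y|N s n] /=.
  by move=> [|] /(occurs_trans uv) h; [left|right].
by move=> [k /(occurs_trans uv) h]; exists k.
Qed.

(** By induction: if [t] occurred in an immediate subterm [c], then [c], which occurs below [t],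
    would occur below itself. *)
Lemma not_occurs_below t : ~ occurs_below t t.
Proof.
have step c t' : ~ occurs_below c c -> occurs_below c t' -> occurs t' c -> False.
  move=> irr below /occursE[E|h]; first by apply: irr; rewrite {2}E.
  by apply: irr; apply: occurs_below_trans h; apply/occursE; right.
elim: t => [x /= []|a x IHx y IHy|N s IH n].
  move=> [] h; [apply: (step x _ IHx _ h)|apply: (step y _ IHy _ h)] => /=.
    by left; apply/occursE; left.
  by right; apply/occursE; left.
move=> [k h]; apply: (step _ _ (IH k) _ h) => /=.
by exists k; apply/occursE; left.
Qed.

Variables (N0 : PP -> R) (s0 : nat -> term).

Fixpoint clean t : Prop := match t with
  | Base _ => True
  | Lin _ x y => clean x /\ clean y
  | Ext N s _ => ~ (N = N0 /\ s = s0) /\ forall k, clean (s k)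
  end.

Lemma not_clean t : ~ clean t -> exists n, occurs (Ext N0 s0 n) t.
Proof.
elim: t => [x|a x IHx y IHy|N s IH n] /=; first by [].
  move=> /not_andP[/IHx|/IHy] [k h]; exists k; right; [by left|by right].
move=> /not_andP[/contrapT[-> ->]|]; first by exists n; left.
by move=> /existsNP[k /IH[m h]]; exists m; right; exists k.
Qed.

(** An extension of [s0] has [s0 k] below it, so its occurrence in [s0 k] would place [s0 k] below
    itself. *)
Lemma clean_s0 k : clean (s0 k).
Proof.
apply: contrapT => /not_clean[n h]; apply: (@not_occurs_below (s0 k)).
have below : occurs_below (s0 k) (Ext N0 s0 n).
  by exists k; apply/occursE; left.
have /occursE[E|h'] := h; first by rewrite {2}E.
by apply: occurs_below_trans h'; apply/occursE; right.
Qed.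

(* The world that agrees with [lam] on the terms not involving the extension
   [(N0, s0)], and with [l] on that extension. *)
Fixpoint amalgam (lam : term -> K^o) (l : PP -> K^o) (t : term) : K^o :=
  match t with
  | Base x => lam (Base x)
  | Lin a x y => a *: amalgam lam l x + amalgam lam l y
  | Ext N s n =>
    if `[< N = N0 /\ s = s0 >] then l (0, 'X^n)
    else if `[< forall k, clean (s k) >] then lam (Ext N s n)
    else chosen_extension S N (fun k => amalgam lam l (s k)) n
  end.

Lemma amalgam_clean lam l t : world lam -> clean t -> amalgam lam l t = lam t.
Proof.
move=> w; elim: t => [//|a x IHx y IHy|N s IH n] /=.
  by move=> [/IHx -> /IHy ->]; rewrite (world_linear w).2.
move=> [h1 h2]; case: asboolP => [/h1//|_].
by case: asboolP.
Qed.

Hypothesis hN0 : seminorm S N0.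
Hypothesis hs0 : forall f, pt (tev s0 f) <= N0 (f, 0).

Definition compatible (lam : term -> K^o) (l : PP -> K^o) : Prop :=
  [/\ world lam, forall a x y, l (a *: x + y) = a *: l x + l y,
      forall x, nr (l x) <= N0 x & forall n, l ('X^n, 0) = lam (s0 n)].

(** Hahn-Banach for the seminorm [N0]. That every world has a partner [l] allows a domination known
    for amalgams to be transferred to all worlds. *)
Lemma compatible_exists lam : world lam -> exists l, compatible lam l.
Proof.
move=> w; pose c n : PP := ('X^n, 0).
have [f|l [llin lc lN]] := @hahn_banach_seq _ _ S _ N0 c (lam \o s0) hN0.
  rewrite -linear_assignment_tev; last exact: (world_linear w).
  apply: (le_trans (pt_ub _ w)).
  suff -> : ev c f = (f, 0) by exact: hs0.
  by rewrite [RHS]ev_pair ev0 addr0.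
by exists l; split.
Qed.

(** Three kinds of extensions occur. For [(N0, s0)] the bound is that of [l]; over a clean sequence
    amalgams take the values of worlds; over any other sequence the values were chosen by the scalar
    extension property. *)
Lemma good_amalgam :
  good S [set phi : term -> K^o | exists lam l, compatible lam l /\ phi = amalgam lam l].
Proof.
split=> [_ [lam [l [[w llin lN lc] ->]]]|N s hN hd _ [lam [l [hc ->]]]].
  have [wB wL wb wE] := (good_world S X).1 _ w.
  split=> //= N s n; case: asboolP => [[-> _]|_].
    exact: (le_trans (lN _) (ler_norm _)).
  by case: asboolP => // _; exact: chosen_extension_bound.
have [w llin lN lc] := hc.
have [[EN Es]|nE] := pselect (N = N0 /\ s = s0).
  subst N s => f g; apply: le_trans (lN (f, g)).
  rewrite (lin_ev_pair f g llin) le_eqVlt; apply/orP; left; apply/eqP.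
  rewrite (_ : ev _ f = ev (fun n => l ('X^n, 0)) f); last first.
    by apply: eq_ev => n /=; rewrite lc amalgam_clean//; exact: clean_s0.
  rewrite (_ : ev _ g = ev (fun n => l (0, 'X^n)) g)//.
  by apply: eq_ev => n /=; case: asboolP => // -[].
have [cs|ncs] := pselect (forall k, clean (s k)).
  move=> f g; rewrite (_ : ev _ f = ev (lam \o s) f); last first.
    by apply: eq_ev => n /=; rewrite amalgam_clean.
  rewrite (_ : ev _ g = ev (lam \o Ext N s) g); last first.
    by apply: eq_ev => n /=; case: asboolP => // _; case: asboolP.
  (* Goodness of the worlds asks for domination by an arbitrary world [psi]; on clean terms [psi]
     agrees with one of its amalgams. *)
  apply: (good_world S X).2 => // psi h wpsi.
  have [m hm] := compatible_exists wpsi.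
  rewrite (_ : ev _ h = ev (amalgam psi m \o s) h).
    by apply: hd; exists psi, m.
  by apply: eq_ev => n /=; rewrite amalgam_clean.
move=> f g; rewrite (_ : ev _ g = ev (chosen_extension S N (amalgam lam l \o s)) g).
  apply: chosen_extensionP; apply: scalar_extension_property => // h.
  by apply: hd; exists lam, l.
by apply: eq_ev => n /=; case: asboolP => // _; case: asboolP.
Qed.

Lemma world_amalgam lam l : compatible lam l -> world (amalgam lam l).
Proof.
move=> h; exists (fun phi => exists lam l, compatible lam l /\ phi = amalgam lam l).
  exact: good_amalgam.
by exists lam, l.
Qed.

End Free.

(** * Isometric extension of codes in the term space *)

Section Disposition.
Context {R : realType} {K : numFieldType} (S : scalars R K).
Variable X : normedModType K.
Local Notation nr := (@nr R K S _).
Local Notation PP := ({poly K} * {poly K})%type.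
Local Notation term := (@term R K X).
Local Notation pt := (@pt R K S X).
Local Notation U := (term_space S X).

Lemma den_bpred t : @den R K S X t \in bpred (B := term_bspace S X).
Proof. by apply/asboolP; exists t. Qed.

Definition cls (t : term) : U := BanachOf (den_bpred t).

Lemma clsP (x : U) : exists t, x = cls t.
Proof.
have [t _ tx] := bMval x; exists t.
by apply: val_inj; rewrite /= tx.
Qed.

Lemma nr_cls t : nr (cls t) = pt t.
Proof. by rewrite nr_bval. Qed.

Lemma cls_lin a s t : cls (Lin a s t) = a *: cls s + cls t.
Proof. by apply: val_inj; rewrite /= denLin. Qed.

Lemma cls0 : cls (Base 0) = 0.
Proof. by apply: val_inj; rewrite /= den0. Qed.

Lemma cls_tev s f : cls (tev s f) = ev (cls \o s) f.
Proof. by apply: tevE; [exact: cls0|exact: cls_lin]. Qed.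

Lemma cls_base_lin a x y : cls (Base (a *: x + y)) = a *: cls (Base x) + cls (Base y).
Proof.
apply: val_inj; apply/funext => -[phi w] /=.
by rewrite /den /= (world_linear w).1.
Qed.

(** The new vectors are the formal extensions [Ext N s]. Every world respects [N], which gives the
    upper bound; for the lower bound some world must attain [N (f, g)]. *)
Lemma term_space_disposition (N : PP -> R) (w : nat -> U) : seminorm S N ->
  (forall f, nr (ev w f) = N (f, 0)) ->
  exists v : nat -> U, forall f g, nr (ev w f + ev v g) = N (f, g).
Proof.
move=> hN hw; have /choice[s sE] n := clsP (w n).
have evw f : ev w f = cls (tev s f) by rewrite cls_tev; apply: eq_ev => n; rewrite sE.
have hs f : pt (tev s f) = N (f, 0) by rewrite -hw evw nr_cls.
have hs' f : pt (tev s f) <= N (f, 0) by rewrite hs.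
exists (cls \o Ext N s) => f g.
have -> : ev w f + ev (cls \o Ext N s) g = cls (Lin 1 (tev s f) (tev (Ext N s) g)).
  by rewrite cls_lin scale1r evw !cls_tev.
rewrite nr_cls; apply/le_anti/andP; split.
  apply: pt_le => phi wphi; rewrite linear_assignment_node; last exact: (world_linear wphi).
  exact: world_node.
(* The functional [l] attains [N (f, g)]. Its restriction to the first factor is a contraction on
   the span of [w]; extended to the whole space it becomes a world, to be amalgamated with [l]. *)
have [l [llin lfg lN]] := norming (f, g) hN.
have [h|F [Flin Fw Fle]] :=
  @hahn_banach_seq _ _ S U nr w (fun n => l ('X^n, 0)) (nr_seminorm S U).
  rewrite hw; have := lN (h, 0); rewrite (lin_ev_pair h 0 llin) ev0 addr0.
  exact.
have wF : world S (F \o cls).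
  apply: world_maximal; first by split=> * /=; rewrite ?cls_base_lin ?cls_lin Flin.
  by move=> t; rewrite -nr_cls; exact: Fle.
have hc : compatible S N s (F \o cls) l.
  by split=> // n; rewrite -Fw /= sE.
have := pt_ub (Lin 1 (tev s f) (tev (Ext N s) g)) (world_amalgam hN hs' hc).
rewrite linear_assignment_node; last exact: (world_linear (world_amalgam hN hs' hc)).
move=> h; apply: le_trans h.
rewrite (_ : ev _ f = ev (fun n => l ('X^n, 0)) f); last first.
  apply: eq_ev => n /=; rewrite amalgam_clean//; last exact: clean_s0.
  by rewrite -Fw /= sE.
rewrite (_ : ev _ g = ev (fun n => l (0, 'X^n)) g); last first.
  by apply: eq_ev => n /=; case: asboolP => // -[].
by rewrite -(lin_ev_pair f g llin) lfg nr_iota//; exact: (seminorm_ge0 _ hN).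
Qed.

End Disposition.

(** * Extension by continuity, closed spans and separability *)

Section Density.
Context {R : realType} {K : numFieldType} (S : scalars R K).
Local Notation iota := (iota S).
Local Notation nr := (@nr R K S _).

Definition is_linear (V W : lmodType K) (f : V -> W) : Prop :=
  forall a x y, f (a *: x + y) = a *: f x + f y.

Lemma is_linear0 (V W : lmodType K) (f : V -> W) : is_linear f -> f 0 = 0.
Proof.
move=> h; have := h 1 0 0; rewrite scaler0 addr0 scale1r.
by move=> /esym/eqP; rewrite -subr_eq0 addrK => /eqP.
Qed.

Lemma is_linearB (V W : lmodType K) (f : V -> W) x y : is_linear f ->
  f (x - y) = f x - f y.
Proof. by move=> h; rewrite addrC -scaleN1r h scaleN1r addrC. Qed.

Lemma is_linearZ (V W : lmodType K) (f : V -> W) a x : is_linear f ->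
  f (a *: x) = a *: f x.
Proof. by move=> h; rewrite -[a *: x]addr0 h (is_linear0 h) addr0. Qed.

Lemma linear_bundle (V W : lmodType K) (f : V -> W) : is_linear f ->
  exists F : {linear V -> W}, F = f :> (V -> W).
Proof.
by move=> h; exists (HB.pack_for {linear V -> W} f (GRing.isLinear.Build K V W *:%R f h)).
Qed.

Definition dense_range (P : Type) (V : normedModType K) (x : P -> V) : Prop :=
  forall z e, 0 < e -> exists f, nr (z - x f) <= e.

Lemma nr_distC (V : normedModType K) (x y : V) : nr (x - y) = nr (y - x).
Proof. by rewrite -nrN opprB. Qed.

Lemma nr_triangle (V : normedModType K) (y x z : V) :
  nr (x - z) <= nr (x - y) + nr (y - z).
Proof. by apply: le_trans (ler_nrD _ _ _); rewrite addrA subrK. Qed.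

Lemma nr_eq_small (V : normedModType K) (x y : V) :
  (forall e, 0 < e -> nr (x - y) <= e) -> x = y.
Proof.
move=> h; apply/eqP; rewrite -subr_eq0; apply/eqP/(@nr_eq0 _ _ S).
by apply/ler_addgt0Pr => e e0; rewrite add0r h.
Qed.

Definition seqcomplete (V : normedModType K) : Prop :=
  forall s : nat -> V, seqcauchy nr s -> exists x, seqlim nr s x.

(** [Q] is the closure of the relation between [x f] and [v f]: completeness of [W] makes it total,
    and the contraction bound makes it single-valued. *)
Lemma contraction_extension (P : lmodType K) (V W : normedModType K)
    (x : P -> V) (v : P -> W) : seqcomplete W ->
  is_linear x -> is_linear v -> dense_range x -> (forall f, nr (v f) <= nr (x f)) ->
  exists T : {linear V -> W}, (forall f, T (x f) = v f) /\
    forall z, nr (T z) <= nr z.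
Proof.
move=> Wc xlin vlin xd vx.
pose Q z y := forall e, 0 < e -> exists f, nr (z - x f) <= e /\ nr (y - v f) <= e.
have vB f g : nr (v f - v g) <= nr (x f - x g) by rewrite -!is_linearB.
have /choice[T TQ] z : exists y, Q z y.
  have /choice[f fz] n : exists f, nr (z - x f) <= n.+1%:R^-1.
    by apply: xd; rewrite invr_gt0 ltr0n.
  have [|y vy] := Wc (v \o f).
    move=> e e0; have [N hN] := harmonic_small (ltac:(lra) : 0 < e / 2).
    exists N => m n Nm Nn; apply: (le_trans (vB _ _)).
    apply: (le_trans (nr_triangle z _ _)); rewrite nr_distC [leRHS]splitr.
    by rewrite lerD// (le_trans (fz _))// ltW// hN.
  exists y => e e0; have [N hN] := harmonic_small e0; have [M hM] := vy _ e0.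
  exists (f (maxn M N)); split.
    by apply: (le_trans (fz _)); rewrite ltW// hN// leq_maxr.
  by rewrite nr_distC; apply: hM; rewrite leq_maxl.
have Quniq z y y' : Q z y -> Q z y' -> y = y'.
  move=> h h'; apply: nr_eq_small => e e0.
  have [f [f1 f2]] := h (e / 4) ltac:(lra); have [g [g1 g2]] := h' (e / 4) ltac:(lra).
  have := nr_triangle (v f) y y'; have := nr_triangle (v g) (v f) y'.
  have := vB f g; have := nr_triangle z (x f) (x g).
  by move: f1 g2; rewrite (nr_distC z (x f)) (nr_distC y' (v g)); lra.
have Qx f : Q (x f) (v f) by move=> e e0; exists f; rewrite !subrr !nr0; split; exact: ltW.
have Qlin a z z' y y' : Q z y -> Q z' y' -> Q (a *: z + z') (a *: y + y').
  move=> h h' e e0; pose d := e / (nr a + 1).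
  have a1 : 0 < nr a + 1 by rewrite ltr_wpDl ?nr_ge0.
  have d0 : 0 < d by rewrite divr_gt0.
  have ed : nr a * d + d = e by rewrite /d; field; rewrite gt_eqF.
  have [f [f1 f2]] := h d d0; have [g [g1 g2]] := h' d d0.
  have E (L : lmodType K) (u u' b b' : L) :
      a *: u + u' - (a *: b + b') = a *: (u - b) + (u' - b').
    by rewrite opprD addrACA -scalerBr.
  exists (a *: f + g); rewrite xlin vlin !E.
  split; (apply: (le_trans (ler_nrD _ _ _)); rewrite nrZ -ed lerD//).
    by rewrite ler_wpM2l// nr_ge0.
  by rewrite ler_wpM2l// nr_ge0.
have Tlin : is_linear T by move=> a z z'; apply: (Quniq _ _ _ (TQ _)); exact: Qlin.
have [F FE] := linear_bundle Tlin.
exists F; rewrite FE; split=> [f|z]; first exact: (Quniq _ _ _ (TQ _) (Qx _)).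
apply/ler_addgt0Pr => e e0; have [f [f1 f2]] := TQ z (e / 2) ltac:(lra).
have := nr_triangle (v f) (T z) 0; have := nr_triangle z (x f) 0.
by have := vx f; rewrite (nr_distC (x f) z) !subr0; lra.
Qed.

Lemma isometry_extension (P : lmodType K) (V W : normedModType K)
    (x : P -> V) (v : P -> W) : seqcomplete W ->
  is_linear x -> is_linear v -> dense_range x -> (forall f, nr (v f) = nr (x f)) ->
  exists T : {linear V -> W}, (forall f, T (x f) = v f) /\
    forall z, nr (T z) = nr z.
Proof.
move=> Wc xlin vlin xd vx.
have [|T [Tx Tn]] := contraction_extension Wc xlin vlin xd; first by move=> f; rewrite vx.
exists T; split=> // z; apply/le_anti; rewrite Tn /=.
apply/ler_addgt0Pr => e e0; have [f fz] := xd z (e / 2) ltac:(lra).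
have := nr_triangle (x f) z 0; have := nr_triangle (T z) (T (x f)) 0.
rewrite -linearB; have := Tn (x f - z); rewrite (nr_distC (x f) z) !subr0 Tx vx; lra.
Qed.

Section Closure.
Variables (P : lmodType K) (V : normedModType K) (x : P -> V).
Hypothesis xlin : is_linear x.
Hypothesis Vc : seqcomplete V.

Definition adherent (z : V) : Prop := forall e, 0 < e -> exists f, nr (z - x f) <= e.

Lemma adherent0 : adherent 0.
Proof. by move=> e e0; exists 0; rewrite (is_linear0 xlin) subrr nr0 ltW. Qed.

Lemma adherent_lin a y z : adherent y -> adherent z -> adherent (a *: y + z).
Proof.
move=> h h' e e0; pose d := e / (nr a + 1).
have a1 : 0 < nr a + 1 by rewrite ltr_wpDl ?nr_ge0.
have d0 : 0 < d by rewrite divr_gt0.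
have ed : nr a * d + d = e by rewrite /d; field; rewrite gt_eqF.
have [f hf] := h d d0; have [g hg] := h' d d0.
exists (a *: f + g); rewrite xlin opprD (addrACA (a *: _)) -scalerBr.
apply: (le_trans (ler_nrD _ _ _)); rewrite nrZ -ed lerD//.
by rewrite ler_wpM2l// nr_ge0.
Qed.

Lemma adherent_complete s : (forall n, adherent (s n)) -> seqcauchy nr s ->
  exists2 z, adherent z & seqlim nr s z.
Proof.
move=> sa /Vc[z sz]; exists z => // e e0.
have [N hN] := sz (e / 2) ltac:(lra); have [f hf] := sa N (e / 2) ltac:(lra).
exists f; have := nr_triangle (s N) z (x f); have := hN _ (leqnn N).
by rewrite (nr_distC z (s N)); lra.
Qed.

Definition closure_bspace : bspace S :=
  @BSpace R K S V adherent nr adherent0 adherent_lin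
    (fun x y _ _ => ler_nrD S x y) (fun a x _ => nrZ S a x)
    (fun x _ => nr_ge0 S x)
    (fun x _ h => nr_eq0 (eq_ind_r (fun r => r <= 0) (lexx 0) h))
    adherent_complete.

Definition closed_span : completeNormedModType K := banach closure_bspace.

Lemma closed_spanP : exists y : P -> closed_span,
  [/\ is_linear y, dense_range y & forall f, nr (y f) = nr (x f)].
Proof.
have xb f : x f \in bpred (B := closure_bspace).
  by apply/asboolP => e e0; exists f; rewrite subrr nr0 ltW.
exists (fun f => BanachOf (xb f)); split.
- by move=> a f g; apply: val_inj => /=; rewrite xlin.
- move=> z e e0; have za : adherent (bval z) := bMval z.
  have [f hf] := za e e0; exists f.
  by rewrite nr_bval.
- by move=> f; rewrite nr_bval.
Qed.

End Closure.

Lemma ball_nr (V : normedModType K) (x y : V) e :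
  ball x (iota e) y <-> nr (x - y) < e.
Proof. by rewrite -ball_normE /= -(iota_nr S) ltr_iota. Qed.

Lemma separable_dense_seq (V : normedModType K) : separable V ->
  exists x : nat -> V, dense_range x.
Proof.
move=> [D /pcard_injP[h hinj] Dd].
(* The countable set is enumerated by inverting an injection into [nat], with [0] at the indices
   that are not hit. *)
exists (fun n => xget 0 [set d | D d /\ h d = n]) => z e e0.
have [||d [dz Dd']] := Dd (ball z (iota e))^°.
- exists z; apply: nbhsx_ballx; by rewrite iota_gt0.
- exact: open_interior.
exists (h d); case: xgetP => [d' _ /= [Dd'' hd]|/(_ d)]; last by case.
have -> : d' = d by apply: hinj; rewrite ?inE.
by apply/ltW/ball_nr; exact: interior_subset dz.
Qed.

(** For each point of a dense sequence and each radius [1 / (k + 1)], pick a point of [Y] that close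
    to it if there is one, and [y0] otherwise. *)
Lemma separable_subset_seq (V : normedModType K) (Y : set V) y0 : separable V ->
  Y y0 -> exists y : nat -> V, (forall n, Y (y n)) /\
    forall z e, Y z -> 0 < e -> exists n, nr (z - y n) <= e.
Proof.
move=> /separable_dense_seq[x xd] Yy0.
have /choice[y yP] (n : nat * nat) : exists y, Y y /\
    forall z, Y z -> nr (z - x n.1) <= n.2.+1%:R^-1 -> nr (y - x n.1) <= n.2.+1%:R^-1.
  have [[z [Yz hz]]|h] := pselect (exists z, Y z /\ nr (z - x n.1) <= n.2.+1%:R^-1).
    by exists z.
  by exists y0; split=> // z Yz hz; case: h; exists z.
exists (fun n => y (odflt (0, 0)%N (unpickle n))); split=> [n|z e Yz e0].
  exact: (yP _).1.
have [k hk] := harmonic_small (ltac:(lra) : 0 < e / 2).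
have [|n hn] := xd z (k.+1%:R^-1); first by rewrite invr_gt0 ltr0n.
exists (pickle (n, k)); rewrite pickleK /=.
apply: (le_trans (nr_triangle (x n) _ _)).
have := (yP (n, k)).2 _ Yz hn; rewrite /= (nr_distC _ (x n)) => h.
rewrite [leRHS]splitr; apply: lerD; first exact: (le_trans hn (ltW (hk _ (leqnn k)))).
exact: (le_trans h (ltW (hk _ (leqnn k)))).
Qed.

Fixpoint comb (V : lmodType K) (b : nat -> V) (c : seq K) (n : nat) : V :=
  if c is a :: c' then a *: b n + comb b c' n.+1 else 0.

Lemma ev_comb (V : lmodType K) (b : nat -> V) (f : {poly K}) : ev b f = comb b f 0.
Proof.
have h (c : seq K) n : comb b c n = \sum_(i < size c) c`_i *: b (n + i)%N.
  elim: c n => [|a c IH] n /=; first by rewrite big_ord0.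
  rewrite IH big_ord_recl /= addn0; congr (_ + _).
  by apply: eq_bigr => i _; rewrite /bump /= addnA addn1.
by rewrite h /ev; apply: eq_bigr.
Qed.

(** Combinations with coefficients in [dseq] are indexed by finite lists of naturals, and
    approximate all combinations one coefficient at a time. *)
Lemma separable_span (V : normedModType K) (b : nat -> V) :
  dense_range (ev b) -> separable V.
Proof.
move=> bd; exists (range (fun c : seq nat => comb b (map (dseq S) c) 0)).
  exact: (card_le_trans (card_image_le _ _) (countableP _)).
have approx (a : seq K) n e : 0 < e -> exists c : seq nat,
    nr (comb b a n - comb b (map (dseq S) c) n) <= e.
  elim: a n e => [|k a IH] n e e0.
    by exists [::]; rewrite /= subrr nr0 ltW.
  have [c hc] := IH n.+1 (e / 2) ltac:(lra).
  have b1 : 0 < nr (b n) + 1 by rewrite ltr_wpDl ?nr_ge0.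
  have [m] := dseq_dense S k (e := e / 2 / (nr (b n) + 1)) ltac:(rewrite !divr_gt0//).
  rewrite -(iota_nr S) ltr_iota ltr_pdivlMr// => hm.
  exists (m :: c); rewrite /= opprD addrACA -scalerBl.
  apply: (le_trans (ler_nrD _ _ _)); rewrite nrZ [leRHS]splitr lerD//.
  by apply: le_trans (ltW hm); rewrite ler_wpM2l ?nr_ge0// lerDl.
move=> O [z Oz] Oo.
have /nbhs_ballP[_ /(iota_gt0_ex S)[e e0 ->] ze] : nbhs z O.
  exact: open_nbhs_nbhs.
have [f hf] := bd z (e / 3) ltac:(lra).
have [c hc] := approx f 0%N (e / 3) ltac:(lra).
exists (comb b (map (dseq S) c) 0); split; last by exists c.
apply: ze; apply/ball_nr; apply: (le_lt_trans (nr_triangle (ev b f) _ _)).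
by move: hc; rewrite -ev_comb; lra.
Qed.

End Density.

(** * Operator norms as real numbers *)

Section OperatorNorm.
Context {R : realType} {K : numFieldType} (S : scalars R K).
Local Notation iota := (iota S).
Local Notation nr := (@nr R K S _).
Variables V W : normedModType K.
Implicit Types (Y : set V) (t : V -> W).

Lemma linear_subspaceP (L : lmodType K) (A : set L) : linear_subspace A <->
  A 0 /\ forall a x y, A x -> A y -> A (a *: x + y).
Proof.
split=> [[A0 Al]|[A0 Al]]; split; rewrite ?inE//.
- by move: A0; rewrite inE.
- by move=> a x y Ax Ay; have := Al a x y; rewrite !inE => /(_ Ax Ay).
- by move=> a x y; rewrite !inE; exact: Al.
Qed.

(** An upper bound of the norms lies above [0] in the order of [K], hence is real. So the supremum
    in [K] is the image of a real supremum. *)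
Lemma opnorm_onP Y t : linear_subspace Y -> operator_on Y t ->
  exists c, [/\ 0 <= c, opnorm_on Y t = iota c,
    forall y, Y y -> nr (t y) <= c * nr y &
    forall d, (forall y, Y y -> nr y <= 1 -> nr (t y) <= d) -> c <= d].
Proof.
move=> /linear_subspaceP[Y0 Yl] [tl tb].
have t0 : t 0 = 0.
  have := tl 1 0 0 Y0 Y0; rewrite scaler0 addr0 scale1r.
  by move=> /esym/eqP; rewrite -subr_eq0 addrK => /eqP.
have YZ a y : Y y -> Y (a *: y) by move=> Yy; rewrite -[_ *: _]addr0; exact: Yl.
have tZ a y : Y y -> t (a *: y) = a *: t y.
  by move=> Yy; rewrite -[a *: y]addr0 tl// t0 addr0.
pose E := [set nr (t y) | y in unit_ball_of Y].
have ball1 y : Y y -> nr y <= 1 -> unit_ball_of Y y.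
  by move=> Yy y1; split=> //; rewrite -(iota_nr S) -(rmorph1 iota) ler_iota.
have E0 : E 0 by exists 0; [apply: ball1; rewrite ?nr0|rewrite t0 nr0].
have Eb : has_ubound E.
  have [M M0 hM] := ex_strict_bound_gt0 tb; have [r _ rM] := iota_gt0_ex S M0.
  exists r => _ [y Yy <-]; rewrite -(ler_iota S) iota_nr -rM ltW//; exact: hM.
have Eub y : Y y -> nr y <= 1 -> nr (t y) <= sup E.
  by move=> Yy y1; apply: ub_le_sup => //; exists y => //; exact: ball1.
have s0 : 0 <= sup E by exact: ub_le_sup.
exists (sup E); split=> //.
- rewrite /opnorm_on /supremum.
  set F := [set `|t y| | y in _].
  have F0 : F !=set0 by exists `|t 0|; exists 0 => //; apply: ball1; rewrite ?nr0.
  have hs : supremums F (iota (sup E)).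
    split=> [_ [y [Yy y1] <-]|k hk].
      rewrite -(iota_nr S) ler_iota; apply: Eub => //.
      by rewrite -(ler_iota S) iota_nr rmorph1.
    have k0 : 0 <= k.
      by apply: le_trans (hk `|t 0| _) => //; exists 0 => //; apply: ball1; rewrite ?nr0.
    rewrite -(reK S k0) ler_iota; apply: ge_sup; first by exists 0.
    by move=> _ [y Yy <-]; rewrite -(ler_iota S) iota_nr reK//; apply: hk; exists y.
  case: ifPn => [/eqP FE|_]; first by move: F0; rewrite FE => -[].
  case: xgetP => [k _ hk|/(_ _ hs)//].
  exact: (is_subset1_supremums hk hs).
- move=> y Yy; have [->|y0] := eqVneq y 0; first by rewrite t0 !nr0 mulr0.
  have ny : 0 < nr y.
    rewrite lt_neqAle nr_ge0 andbT eq_sym; apply: contra_neq y0 => h0.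
    by apply: (nr_eq0 (S := S)); rewrite h0.
  have ni : nr (iota (nr y)^-1) = (nr y)^-1 by rewrite nr_iota// invr_ge0 ltW.
  have := Eub (iota (nr y)^-1 *: y) (YZ _ _ Yy).
  rewrite tZ// !nrZ ni mulVf ?gt_eqF// => /(_ (lexx _)).
  by rewrite ler_pdivrMl// mulrC.
- move=> d hd; apply: ge_sup; first by exists 0.
  move=> _ [y [Yy y1] <-]; apply: hd => //.
  by rewrite -(ler_iota S) iota_nr rmorph1.
Qed.

Lemma bounded_operator Y t c :
  (forall a x y, Y x -> Y y -> t (a *: x + y) = a *: t x + t y) ->
  0 <= c -> (forall y, Y y -> nr (t y) <= c * nr y) -> operator_on Y t.
Proof.
move=> tl c0 hc; split => //; exists (iota c); split.
  by rewrite realE iota_ge0 c0.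
move=> M cM y [Yy y1]; apply: le_trans (ltW cM).
rewrite -(iota_nr S) ler_iota; apply: (le_trans (hc _ Yy)).
rewrite -[leRHS]mulr1 ler_wpM2l//.
by rewrite -(ler_iota S) iota_nr rmorph1.
Qed.

Lemma opnorm_on_le Y t c : linear_subspace Y -> operator_on Y t -> 0 <= c ->
  (forall y, Y y -> nr (t y) <= c * nr y) -> opnorm_on Y t <= iota c.
Proof.
move=> hY ht c0 hc; have [d [d0 -> _ dmin]] := opnorm_onP hY ht.
rewrite ler_iota; apply: dmin => y Yy y1; apply: (le_trans (hc _ Yy)).
by rewrite -[leRHS]mulr1 ler_wpM2l.
Qed.

End OperatorNorm.

(** * Separable spaces and their codes *)

Section Coding.
Context {R : realType} {K : numFieldType} (S : scalars R K).
Local Notation nr := (@nr R K S _).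
Local Notation PP := ({poly K} * {poly K})%type.

Lemma linear_subspaceT (V : lmodType K) : linear_subspace [set: V].
Proof. by apply/linear_subspaceP. Qed.

Lemma separable_code (V : normedModType K) (y : PP -> V) :
  is_linear y -> dense_range S y -> separable V.
Proof.
move=> yl yd.
(* Even indices run through the first factor, odd ones through the second. *)
pose b n := if odd n then y (0, 'X^(n./2)) else y ('X^(n./2), 0).
apply: (separable_span (S := S) (b := b)) => z e e0.
have [[f g] hfg] := yd z e e0.
exists (ev (fun n => 'X^(n.*2) : {poly K}) f + ev (fun n => 'X^(n.*2.+1) : {poly K}) g).
rewrite evD.
rewrite (lin_ev (T := ev b) (fun n => 'X^(n.*2)) f (@ev_lin _ _ b)).
rewrite (lin_ev (T := ev b) (fun n => 'X^(n.*2.+1)) g (@ev_lin _ _ b)).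
have -> : ev (ev b \o (fun n => 'X^(n.*2))) f = ev (fun n => y ('X^n, 0)) f.
  by apply: eq_ev => n /=; rewrite evXn /b odd_double doubleK.
have -> : ev (ev b \o (fun n => 'X^(n.*2.+1))) g = ev (fun n => y (0, 'X^n)) g.
  by apply: eq_ev => n /=; rewrite evXn /b /= odd_double /= uphalf_double.
by rewrite -(lin_ev_pair f g yl).
Qed.

Lemma is_linear_code (V : lmodType K) (c v : nat -> V) :
  is_linear (fun h : PP => ev c h.1 + ev v h.2).
Proof. by move=> a x y; rewrite !ev_lin scalerDr addrACA. Qed.

(** The term space over the scalars already contains a copy: extending the zero sequence by the code
    [N (h.2, 0)] yields a realization [b] of the first factor, and extending [b] by [N] yields the
    rest. *)
Lemma coded_space (N : PP -> R) : seminorm S N ->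
  exists (B : completeNormedModType K) (x : PP -> B),
    [/\ is_linear x, dense_range S x, separable B & forall h, nr (x h) = N h].
Proof.
move=> hN; pose U := term_space S K^o.
have hN1 : seminorm S (fun h : PP => N (h.2, 0)).
  split=> [x y|a x].
    by apply: le_trans (hN.1 _ _); rewrite /= -[in leLHS](addr0 0).
  by rewrite -hN.2; congr N; congr pair; rewrite /= scaler0.
have [f|b hb] := @term_space_disposition _ _ S K^o _ (fun=> 0 : U) hN1.
  rewrite (seminorm0 hN) /ev big1 ?nr0// => i _; exact: scaler0.
have ev_zero f : ev (fun=> 0 : U) f = 0.
  by rewrite /ev big1// => i _; exact: scaler0.
have [f|v hv] := @term_space_disposition _ _ S K^o N b hN.
  by have := hb 0 f; rewrite ev0 add0r.
pose x (h : PP) : U := ev b h.1 + ev v h.2.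
have xl : is_linear x by exact: is_linear_code.
have Uc : seqcomplete S U by move=> s; exact: banach_seqcauchy.
have [y [yl yd yn]] := closed_spanP xl Uc.
exists (closed_span xl Uc), y; split => //; first exact: separable_code yd.
by move=> [f g]; rewrite yn hv.
Qed.

(** In a realization of the code, [c] is an operator of norm at most 1 on the span of the first
    factor. Its extension, evaluated at the second unit vectors, is the required sequence. *)
Lemma separably_injective_extension (E : completeNormedModType K) :
  separably_injective 1 E -> extension_property S E.
Proof.
move=> hE N c hN hc; have [B [x [xl xd Bsep xN]]] := coded_space hN.
pose Y := [set z : B | exists f, z = x (f, 0)].
pose t (z : B) : E := ev c (xget 0 [set f | z = x (f, 0)]).
have x0l a f g : x (a *: f + g, 0) = a *: x (f, 0) + x (g, 0).
  by rewrite -xl; congr x; congr pair; rewrite /= scaler0 addr0.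
have tE f : t (x (f, 0)) = ev c f.
  rewrite /t; case: xgetP => [g _ /= gE|/(_ f)]; last by case.
  apply/eqP; rewrite -subr_eq0; apply/eqP/(@nr_eq0 _ _ S).
  have -> : ev c g - ev c f = ev c (g - f) by rewrite evD evN.
  apply: (le_trans (hc _)); rewrite -xN.
  have -> : x (g - f, 0) = 0.
    by rewrite addrC -scaleN1r x0l gE scaleN1r addNr.
  by rewrite nr0.
have hY : linear_subspace Y.
  apply/linear_subspaceP; split.
    by exists 0; rewrite (_ : (0, 0) = 0 :> PP)// (is_linear0 xl).
  by move=> a _ _ [f ->] [g ->]; exists (a *: f + g); rewrite x0l.
have tb y : Y y -> nr (t y) <= 1 * nr y.
  by move=> [f ->]; rewrite tE mul1r xN.
have ht : operator_on Y t.
  apply: (bounded_operator (S := S) (c := 1)) => //.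
  by move=> a _ _ [f ->] [g ->]; rewrite -x0l !tE ev_lin.
have [T [opT Tt Tn]] := hE B Y t Bsep hY ht.
have Tb z : nr (T z) <= nr z.
  have [d [d0 dE dT _]] := opnorm_onP S (linear_subspaceT B) opT.
  apply: (le_trans (dT z I)); rewrite -[leRHS]mul1r ler_wpM2r ?nr_ge0//.
  rewrite -(ler_iota S) -dE; apply: (le_trans Tn); rewrite mul1r.
  exact: opnorm_on_le.
exists (fun n => T (x (0, 'X^n))) => f g.
rewrite -xN; apply: le_trans (Tb _); rewrite (lin_ev_pair f g xl) linearD.
rewrite (_ : ev c f = T (ev (fun n => x ('X^n, 0)) f)); last first.
  rewrite (lin_ev (T := T)); last exact: linearP.
  by apply: eq_ev => n /=; rewrite Tt ?tE ?evXn//; exists 'X^n.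
by rewrite (lin_ev (T := T) (fun n => x (0, 'X^n)))//; exact: linearP.
Qed.

End Coding.

(** * From separable injectivity to universal disposition *)

Section Forward.
Context {R : realType} {K : numFieldType} (S : scalars R K).
Local Notation nr := (@nr R K S _).
Local Notation PP := ({poly K} * {poly K})%type.

Definition coded_disposition (U : normedModType K) : Prop :=
  forall (N : PP -> R) (w : nat -> U), seminorm S N ->
    (forall f, nr (ev w f) = N (f, 0)) ->
    exists v : nat -> U, forall f g, nr (ev w f + ev v g) = N (f, g).

(** Dense sequences of [A] and [B] code the pair: the first factor runs through the image of [A] and
    the second through [B]. The isometry obtained on combinations then extends by density. *)
Lemma universal_disposition_of_coded (U : completeNormedModType K) :
  coded_disposition U -> universal_disposition (@separable_banach K) U.
Proof.
move=> UD A B u i /(separable_dense_seq S)[a ad] /(separable_dense_seq S)[b bd] hu hi.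
have nu z : nr (u z) = nr z by exact: eq_nr.
have ni z : nr (i z) = nr z by exact: eq_nr.
pose x (h : PP) : B := ev (i \o a) h.1 + ev b h.2.
have xl : is_linear x by exact: is_linear_code.
have hN : seminorm S (fun h => nr (x h)).
  by split=> [h k|c h]; [rewrite -[h]scale1r xl !scale1r; exact: ler_nrD|
    rewrite (is_linearZ _ _ xl) nrZ].
have [f|v hv] := UD _ (u \o a) hN.
  rewrite /x ev0 addr0 -(lin_ev (T := u) a); last exact: linearP.
  by rewrite -(lin_ev (T := i) a); [rewrite nu ni|exact: linearP].
pose y (h : PP) : U := ev (u \o a) h.1 + ev v h.2.
have yl : is_linear y by exact: is_linear_code.
have Uc : seqcomplete S U by move=> s; exact: banach_seqcauchy.
have xd : dense_range S x.
  move=> z e e0; have [n hn] := bd z e e0; exists (0, 'X^n).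
  by rewrite /x ev0 add0r evXn.
have [|T [Tx Tn]] := isometry_extension Uc xl yl xd; first by move=> [f g]; rewrite hv.
exists T => [z|z]; first by rewrite -!(iota_nr S) Tn.
apply: (nr_eq_small (S := S)) => e e0; have [n hn] := ad z (e / 2) ltac:(lra).
have E : T (i (a n)) = u (a n).
  have := Tx ('X^n, 0); rewrite /x /y !ev0 !addr0 !evXn //.
rewrite /=; apply: (le_trans (nr_triangle S (u (a n)) _ _)).
rewrite -{2}E -!linearB nu Tn ni [leRHS]splitr lerD//.
by rewrite nr_distC.
Qed.

Variable E : completeNormedModType K.
Hypothesis hE : extension_property S E.
Local Notation term := (@term R K E).
Local Notation U := (term_space S E).
Local Notation cls := (@cls R K S E).
Local Notation pt := (@pt R K S E).

Fixpoint retract (t : term) : E :=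
  match t with
  | Base x => x
  | Lin a s t => a *: retract s + retract t
  | Ext N s n => chosen_extension S N (fun k => retract (s k)) n
  end.

(** The assignments arising from the dual unit ball of [E] form a good family, because the
    extensions used by [retract] can be found in [E]. *)
Lemma retract_world (psi : E -> K^o) :
  (forall a x y, psi (a *: x + y) = a *: psi x + psi y) ->
  (forall x, nr (psi x) <= nr x) -> world S (psi \o retract).
Proof.
move=> psil psin.
exists (fun phi => exists psi : E -> K^o, [/\ is_linear psi,
  forall x, nr (psi x) <= nr x & phi = psi \o retract]); last by exists psi.
split=> [_ [{psil psin} {}psi [psil psin ->]]|N s hN hd _ [{psil psin} {}psi [psil psin ->]] f g].
  split=> //= N s n; apply: (le_trans (psin _)).
  exact: chosen_extension_bound.
(* A norming functional turns domination of all scalar images into domination of the norm in [E], as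
   the extension property requires. *)
have dom h : nr (ev (retract \o s) h) <= N (h, 0).
  have [F [Fl Fx Fn]] := norming (ev (retract \o s) h) (nr_seminorm S E).
  rewrite -(nr_iota S (nr_ge0 S (ev (retract \o s) h))) -Fx (lin_ev (T := F))//.
  exact: (hd (F \o retract) h (ex_intro _ F (And3 Fl Fn erefl))).
have := chosen_extensionP (hE hN dom) f g.
apply: le_trans; apply: le_trans (psin _).
rewrite -[ev _ f in leRHS]scale1r psil scale1r.
by rewrite (lin_ev _ f psil) (lin_ev _ g psil).
Qed.

Lemma nr_retract t : nr (retract t) <= pt t.
Proof.
have [F [Fl Fx Fn]] := norming (retract t) (nr_seminorm S E).
rewrite -(nr_iota S (nr_ge0 S (retract t))) -Fx.
exact: pt_ub (retract_world Fl Fn).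
Qed.

Lemma nr_base x : nr (cls (Base x)) = nr x.
Proof.
rewrite nr_cls; apply/le_anti; rewrite (nr_retract (Base x)) andbT.
by apply: pt_le => phi /(good_world S E).1[].
Qed.

(** Two terms of the same class differ by a term with [pt] zero, which [retract] sends to zero; so
    evaluation does not depend on the representative. *)
Lemma retraction : exists P : {linear U -> E},
  (forall t, P (cls t) = retract t) /\ forall z, nr (P z) <= nr z.
Proof.
have /choice[r rE] := @clsP R K S E.
have rcls t : retract (r (cls t)) = retract t.
  apply/eqP; rewrite -subr_eq0; apply/eqP/(@nr_eq0 _ _ S).
  have := nr_retract (Lin (-1) t (r (cls t))).
  rewrite -nr_cls cls_lin -rE scaleN1r addNr nr0 /= scaleN1r addrC.
  exact.
have Pl : is_linear (retract \o r).
  move=> a x y /=; rewrite {1}(rE x) {1}(rE y) -cls_lin rcls //.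
have [P PE] := linear_bundle Pl.
exists P; rewrite PE; split => // z /=.
by rewrite {2}(rE z) nr_cls nr_retract.
Qed.

Lemma one_complemented_in_term_space :
  exists Y : set U, one_complemented Y /\ isometric_to_subspace E Y.
Proof.
have [P [Pcls Pn]] := retraction.
have [j jE] := @linear_bundle _ _ _ (fun x => cls (Base x)) (@cls_base_lin R K S E).
have jn x : nr (j x) = nr x by rewrite jE nr_base.
have Pj x : P (j x) = x by rewrite jE Pcls.
have Ql : is_linear (j \o P) by move=> a x y; rewrite /= !linearP.
have [Q QE] := linear_bundle Ql.
have Qn z : nr (Q z) <= 1 * nr z by rewrite mul1r QE /= jn.
have opQ : operator_on setT Q.
  by apply: (bounded_operator (S := S) (c := 1)) => // *; exact: linearP.
exists (range j); split; last by exists j => // x; rewrite -!(iota_nr S) jn.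
split.
- apply/linear_subspaceP; split; first by exists 0; rewrite ?linear0.
  by move=> a _ _ [x _ <-] [y _ <-]; exists (a *: x + y); rewrite ?linearP.
(* For [z] in the closure of the range, [j (P z) = z], since both are within [e / 2] of a common
   [j x]. *)
- move=> z hz; exists (P z) => //; apply: (nr_eq_small (S := S)) => e e0.
  have [_ [[x _ <-] /(ball_nr S) zx]] := hz (ball z (iota S (e / 2)))
    ltac:(by apply: nbhsx_ballx; rewrite iota_gt0; lra).
  apply: (le_trans (nr_triangle S (j x) _ _)).
  rewrite -linearB jn -{1}(Pj x) -linearB [leRHS]splitr lerD//.
    exact: (le_trans (Pn _) (ltW zx)).
  by rewrite nr_distC ltW.
- exists Q; split => //.
  + by move=> z; rewrite QE /= Pj.
  + apply/seteqP; split=> [_ [z _ <-]|_ [x _ <-]]; rewrite QE /=.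
      by exists (P z).
    by exists (j x); rewrite //= Pj.
  + by rewrite -(rmorph1 (iota S)); apply: opnorm_on_le => //; exact: linear_subspaceT.
Qed.

End Forward.

(** * From universal disposition to separable injectivity *)

Section Converse.
Context {R : realType} {K : numFieldType} (S : scalars R K).
Local Notation nr := (@nr R K S _).
Local Notation PP := ({poly K} * {poly K})%type.

(** For nonzero [a] the reverse inequality is the given one for [a^-1]; for [a = 0] it follows from
    subadditivity at [0]. *)
Lemma seminorm_of_le (V : lmodType K) (p : V -> R) :
  (forall x y, p (x + y) <= p x + p y) ->
  (forall a x, p (a *: x) <= nr a * p x) -> seminorm S p.
Proof.
move=> pD pZ; split=> // a x; apply/le_anti; rewrite pZ /=.
have [->|a0] := eqVneq a 0.
  by rewrite nr0 mul0r scale0r; have := pD 0 0; rewrite addr0; lra.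
have na : 0 < nr a.
  rewrite lt_neqAle nr_ge0 andbT eq_sym; apply: contra_neq a0 => h0.
  by apply: (nr_eq0 (S := S)); rewrite h0.
have := pZ a^-1 (a *: x); rewrite scalerA mulVf// scale1r => h.
rewrite -ler_pdivlMl//; apply: (le_trans h).
suff -> : nr a^-1 = (nr a)^-1 by [].
by apply: (mulfI (lt0r_neq0 na)); rewrite -nrM divff// nr1 divff// gt_eqF.
Qed.

(** Realize the code in [B] and let [A] be the closed span of its first factor. The hypothesis on
    [w] gives an isometry of [A] into [U], and extending it to [B] places the second factor. *)
Lemma coded_of_universal_disposition (U : completeNormedModType K) :
  universal_disposition (@separable_banach K) U -> coded_disposition S U.
Proof.
move=> hU N w hN hw; have [B [x [xl xd Bsep xN]]] := coded_space hN.
pose x0 (f : {poly K}) : B := x (f, 0).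
have x0l : is_linear x0.
  by move=> a f g; rewrite /x0 -xl; congr x; congr pair; rewrite /= scaler0 addr0.
have Bc : seqcomplete S B by move=> s; exact: banach_seqcauchy.
have Uc : seqcomplete S U by move=> s; exact: banach_seqcauchy.
have [a [al ad an]] := closed_spanP x0l Bc.
set A := closed_span x0l Bc in a al ad an.
have Asep : separable A.
  apply: (separable_span (S := S) (b := fun n => a 'X^n)) => z e e0.
  by have [f hf] := ad z e e0; exists f; rewrite -(poly_lin f al).
have [f|u [ua un]] := isometry_extension Uc al (@ev_lin _ _ w) ad.
  by rewrite an xN hw.
have [f|i [ia inn]] := isometry_extension Bc al x0l ad; first by rewrite an.
have [||u' u'n uu'] := hU A B u i Asep Bsep.
- by move=> z; rewrite -!(iota_nr S) un.
- by move=> z; rewrite -!(iota_nr S) inn.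
exists (fun n => u' (x (0, 'X^n))) => f g.
rewrite -ua uu' /= ia -(lin_ev (T := u') (fun n => x (0, 'X^n))); last exact: linearP.
rewrite -linearD (eq_nr S (u'n _)) -xN (lin_ev_pair f g xl).
by rewrite /x0 (lin_ev_pair f 0 xl) ev0 addr0.
Qed.

(** Dividing by [c] reduces this to contractions; [c = 0] forces [v = 0]. *)
Lemma lipschitz_extension (P : lmodType K) (V W : normedModType K)
    (x : P -> V) (v : P -> W) c : seqcomplete S W ->
  is_linear x -> is_linear v -> dense_range S x -> 0 <= c ->
  (forall f, nr (v f) <= c * nr (x f)) ->
  exists T : {linear V -> W}, (forall f, T (x f) = v f) /\
    forall z, nr (T z) <= c * nr z.
Proof.
move=> Wc xl vl xd; rewrite le_eqVlt => /orP[/eqP<-|c0] vx.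
  have [T TE] : exists T : {linear V -> W}, T = (fun=> 0) :> (V -> W).
    by apply: linear_bundle => a y z; rewrite scaler0 addr0.
  exists T; rewrite TE; split=> [f|z]; last by rewrite nr0 mul0r.
  by apply/esym/(nr_eq0 (S := S)); apply: (le_trans (vx f)); rewrite mul0r.
pose k := iota S c.
have k0 : k != 0 by rewrite gt_eqF// iota_gt0.
have vl' : is_linear (fun f => k^-1 *: v f).
  by move=> a f g; rewrite vl scalerDr !scalerA mulrC.
have nk : nr k = c by rewrite nr_iota// ltW.
have nki : nr k^-1 = c^-1.
  by apply: (mulfI (lt0r_neq0 c0)); rewrite -{1}nk -nrM divff// nr1 divff// gt_eqF.
have [f|T [Tx Tn]] := contraction_extension Wc xl vl' xd.
  by rewrite nrZ nki ler_pdivrMl.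
have [T' T'E] : exists T' : {linear V -> W}, T' = (fun z => k *: T z) :> (V -> W).
  apply: linear_bundle => a y z.
  by rewrite linearP scalerDr !scalerA mulrC.
exists T'; rewrite T'E; split=> [f|z].
  by rewrite Tx scalerA divff// scale1r.
by rewrite nrZ nk ler_pM2l.
Qed.

(* The seminorm [M] codes the push-out of the inclusion of the span of [y] into
   the span of [x] and of the operator sending [y] to [w]. *)
Lemma operator_extension (U X : completeNormedModType K) (Y : set X)
    (t : X -> U) (c : R) : coded_disposition S U -> separable X ->
  linear_subspace Y -> (forall a x y, Y x -> Y y -> t (a *: x + y) = a *: t x + t y) ->
  0 <= c -> (forall y, Y y -> nr (t y) <= c * nr y) ->
  exists T : {linear X -> U}, (forall y, Y y -> T y = t y) /\
    forall z, nr (T z) <= c * nr z.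
Proof.
move=> hU Xsep /linear_subspaceP[Y0 Yl] tl c0 tc.
have [x xd] := separable_dense_seq S Xsep.
have [y [Yy yd]] := separable_subset_seq S Xsep Y0.
have t0 : t 0 = 0.
  have := tl 1 0 0 Y0 Y0; rewrite scaler0 addr0 scale1r.
  by move=> /esym/eqP; rewrite -subr_eq0 addrK => /eqP.
pose w n := t (y n).
have evy h : Y (ev y h) /\ t (ev y h) = ev w h.
  rewrite /ev; elim: (size h) => [|n [IH1 IH2]]; first by rewrite !big_ord0.
  by rewrite !big_ord_recr /= ![_ + h`__ *: _]addrC -IH2 tl//; split => //; exact: Yl.
have wc h : nr (ev w h) <= c * nr (ev y h).
  by have [h1 <-] := evy h; exact: tc.
(* Moving the combination [h] of [y] from [X] to [U] changes the representative of an element of the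
   push-out; [v0 z h] is the norm of that representative, with [X] rescaled by [c]. *)
pose v0 (z : PP) h := nr (ev w (z.1 + h)) + c * nr (ev x z.2 - ev y h).
have v00 z h : 0 <= v0 z h by rewrite addr_ge0 ?mulr_ge0 ?nr_ge0.
pose M (z : PP) := inf (range (v0 z)).
have Mlb z : has_lbound (range (v0 z)) by exists 0 => _ [h _ <-].
have Mn z : range (v0 z) !=set0 by exists (v0 z 0), 0.
have Mle z h : M z <= v0 z h by apply: ge_inf => //; exists h.
have Mge z r : (forall h, r <= v0 z h) -> r <= M z.
  by move=> hr; apply: lb_le_inf => // _ [h _ <-].
have v0D z z' h h' : v0 (z + z') (h + h') <= v0 z h + v0 z' h'.
  rewrite /v0 /= [leRHS]addrACA; apply: lerD.
    have -> : z.1 + z'.1 + (h + h') = (z.1 + h) + (z'.1 + h') by rewrite addrACA.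
    by rewrite (evD w (z.1 + h)); exact: (ler_nrD S).
  rewrite -mulrDr ler_wpM2l// !evD opprD addrACA; exact: ler_nrD.
have v0Z a z h : v0 (a *: z) (a *: h) = nr a * v0 z h.
  by rewrite /v0 /= -scalerDr !evZ -scalerBr !nrZ; ring.
have hM : seminorm S M.
  apply: seminorm_of_le => [z z'|a z].
    rewrite -lerBlDr; apply: (Mge) => h; rewrite lerBlDr -lerBlDl.
    by apply: (Mge) => h'; rewrite lerBlDl; exact: le_trans (Mle _ _) (v0D _ _ _ _).
  have [a0|a0] := eqVneq (nr a) 0.
    rewrite a0 mul0r; apply: (le_trans (Mle _ (a *: 0))).
    by rewrite v0Z a0 mul0r.
  have na : 0 < nr a by rewrite lt_neqAle eq_sym a0 nr_ge0.
  rewrite -ler_pdivrMl//; apply: (Mge) => h; rewrite ler_pdivrMl// -v0Z; exact: Mle.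
(* The push-out contains [U] isometrically, because [wc] keeps a change of representative from
   lowering the norm. *)
have M0 f : nr (ev w f) = M (f, 0).
  apply/le_anti/andP; split.
    apply: (Mge) => h; rewrite /v0 /= ev0 sub0r nrN.
    have -> : ev w f = ev w (f + h) - ev w h by rewrite evD addrK.
    by apply: (le_trans (ler_nrD _ _ _)); rewrite nrN lerD.
  by apply: (le_trans (Mle _ 0)); rewrite /v0 /= !ev0 subr0 nr0 mulr0 !addr0.
have [v vM] := hU M w hM M0.
have Uc : seqcomplete S U by move=> s; exact: banach_seqcauchy.
have xd' : dense_range S (ev x).
  by move=> z e e0; have [n hn] := xd z e e0; exists 'X^n; rewrite evXn.
have [g|T [Tx Tn]] := lipschitz_extension Uc (@ev_lin _ _ x) (@ev_lin _ _ v) xd' c0.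
  have := vM 0 g; rewrite ev0 add0r => ->; apply: (le_trans (Mle _ 0)).
  by rewrite /v0 /= addr0 !ev0 nr0 add0r subr0.
have small (z : X) (u : U) (a : nat -> X) :
    (forall e, 0 < e -> exists n, nr (z - a n) <= e) ->
    (forall n, nr (T (a n) - u) <= c * nr (z - a n)) -> T z = u.
  move=> ha hb; apply: (nr_eq_small (S := S)) => e e0.
  (* Two errors of [c] times the distance add up to a factor [2 * c]; the [+ 1] also covers
     [c = 0]. *)
  have d0 : 0 < e / (2 * c + 1) by rewrite divr_gt0// ltr_wpDl ?mulr_ge0.
  have [n hn] := ha _ d0.
  apply: (le_trans (nr_triangle S (T (a n)) _ _)); rewrite -linearB.
  apply: (le_trans (lerD (Tn _) (hb n))); rewrite -mulr2n -mulrnAl.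
  apply: (le_trans (ler_wpM2l _ hn)); first by rewrite mulrn_wge0.
  rewrite mulrA ler_pdivrMr ?ltr_wpDl ?mulr_ge0// mulrC ler_wpM2l ?ltW//.
  by rewrite -mulr_natl ltrDl.
have Ty n : T (y n) = w n.
  apply: (small _ _ x (xd (y n))) => m.
  (* Choosing the representative [h = 'X^n] cancels the first component and leaves [c] times the
     distance from [x m] to [y n]. *)
  have := vM (- 'X^n) 'X^m; rewrite evN !evXn addrC => h.
  rewrite -[x m](evXn x) Tx !evXn h; apply: (le_trans (Mle _ 'X^n)).
  by rewrite /v0 /= addNr ev0 nr0 add0r !evXn nr_distC.
exists T; split=> // z Yz; apply: (small _ _ y) => [e e0|n]; first exact: yd.
have YB : Y (y n - z) by rewrite addrC -scaleN1r; exact: Yl.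
rewrite Ty /w; have -> : t (y n) - t z = t (y n - z).
  by rewrite (addrC (y n)) -[- z]scaleN1r tl// scaleN1r addrC.
by rewrite (nr_distC S z); exact: tc.
Qed.

(** Extend [j \o t] into [U] with the same norm, project by [Q], and pull back along the isometry
    [j]. *)
Lemma one_complemented_separably_injective (E U : completeNormedModType K)
    (Y : set U) : universal_disposition (@separable_banach K) U ->
  one_complemented Y -> isometric_to_subspace E Y -> separably_injective 1 E.
Proof.
move=> /coded_of_universal_disposition hU [_ _ [Q [opQ QQ rQ Qn]]] [j hj rj].
move=> X Z t Xsep hZ opt.
have nj z : nr (j z) = nr z by exact: eq_nr.
have [c [c0 cE tc _]] := opnorm_onP S hZ opt.
have nQ z : nr (Q z) <= nr z.
  have [d [d0 dE dQ _]] := opnorm_onP S (linear_subspaceT U) opQ.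
  apply: (le_trans (dQ z I)); rewrite -[leRHS]mul1r ler_wpM2r ?nr_ge0//.
  by rewrite -(ler_iota S) -dE rmorph1.
have [|y Zy|T [Tt Tn]] := @operator_extension U X Z (j \o t) c hU Xsep hZ _ c0.
- by move=> a x y Zx Zy /=; rewrite opt.1// linearP.
- by rewrite /= nj; exact: tc.
have /choice[q qE] u : exists e, j e = Q u.
  have : range j (Q u) by rewrite rj -rQ; exists u.
  by move=> [e _ eu]; exists e.
have jinj e e' : j e = j e' -> e = e'.
  move=> h; apply/eqP; rewrite -subr_eq0; apply/eqP/(@nr_eq0 _ _ S).
  by rewrite -nj linearB h subrr nr0.
have [F FE] : exists F : {linear X -> E}, F = q \o T :> (X -> E).
  by apply: linear_bundle => a x y; apply: jinj; rewrite linearP /= !qE !linearP.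
have Fn z : nr (F z) <= c * nr z.
  by rewrite FE /= -nj qE (le_trans (nQ _)).
have opF : operator_on setT F.
  by apply: (bounded_operator (S := S) (c := c)) => // *; exact: linearP.
exists F; split => //.
- move=> z Zz; rewrite FE /=; apply: jinj; rewrite qE Tt//=.
  (* Values of [j] lie in the range of [Q], where the idempotent [Q] acts as the identity. *)
  have [u _ uE] : range Q (j (t z)) by rewrite rQ -rj; exists (t z).
  by rewrite -uE QQ.
- rewrite mul1r cE; apply: opnorm_on_le => //; exact: linear_subspaceT.
Qed.

End Converse.

Theorem proposition0p1 (R : realType) (K : numFieldType)
    (hK : scalar_field R K) (E : completeNormedModType K) :
  separably_injective 1 E <->
  exists (U : completeNormedModType K) (Y : set U),
    [/\ universal_disposition (@separable_banach K) U,
        one_complemented Y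
      & isometric_to_subspace E Y].

Proof.
have [S] := scalar_fieldP hK; split=> [hE|[U [Y [hU hY hEY]]]].
  have [Y [hY hEY]] :=
    one_complemented_in_term_space (separably_injective_extension (S := S) hE).
  exists (term_space S E), Y; split => //.
  by apply: (universal_disposition_of_coded (S := S)) => N w; exact: term_space_disposition.
exact: (one_complemented_separably_injective S hU hY hEY).
Qed.
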